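(* Let $\mathcal{X}\subseteq\mathbb{R}^n$ be compact, let $f:\mathbb{R}^n\to\mathbb{R}^n$ be smooth, let $g\in\mathbb{R}^{n\times m}$ be a constant matrix, and let $u_\theta:\mathbb{R}^n\to\mathbb{R}^m$ be a neural-network state feedback of the form described in the context. Let $x^\star\in\mathcal{X}$ satisfy $f(x^\star)+g\,u_\theta(x^\star)=0$. Let $M_\phi:\mathcal{X}\to\mathbb{S}_{\succ0}$ be a smooth map into the set of symmetric positive definite $n\times n$ matrices, let $\rho>0$, and let $c_1,c_2\in\mathbb{R}$ satisfy $$c_1\ \ge\ 2\rho\,\sup_{s\in\mathcal{X}}\bar\lambda\big(M_\phi(s)\big),\qquad c_2\ \ge\ \sup_{s\in\mathcal{X}}\bar\lambda\big(\mathrm{Sym}[M_\phi(s)\,\partial_s f(s)]\big).$$ Put $\eta:=c_1+c_2$. Let $L_\theta,U_\theta,L_\phi,U_\phi\in\mathbb{R}^{n\times n}$ be constant matrices such that, entrywise and for all $x\in\mathcal{X}$, $$L_\theta\le M_\phi(x)\,g\,\partial_x u_\theta(x)\le U_\theta,\qquad L_\phi\le \dot M_\phi(x)\le U_\phi,$$ and set $L:=L_\theta+L_\phi$, $U:=U_\theta+U_\phi$. If for every $i\in\{1,\dots,n\}$ $$2U_{ii}+\eta\ \le\ -\sum_{j\ne i}\max\big\{|L_{ij}+L_{ji}|,\ |U_{ij}+U_{ji}|\big\},$$ then $x^\star$ is an exponentially stable equilibrium point of the closed-loop system $\dot x=f(x)+g\,u_\theta(x)$.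
   Context: Notation: $\mathrm{Sym}[A]:=A+A^\top$ for a square matrix $A$ (no factor $1/2$); $\bar\lambda(A)$ is the largest eigenvalue of a symmetric matrix $A$; for matrices of equal size, $A\le B$ means $A_{ij}\le B_{ij}$ for all $i,j$. $\partial_x f(x)\in\mathbb{R}^{n\times n}$ and $\partial_x u_\theta(x)\in\mathbb{R}^{m\times n}$ are Jacobian matrices. $\dot M_\phi(x)$ is the derivative of $M_\phi$ along the closed-loop vector field, i.e. the $n\times n$ matrix with entries $\sum_{k=1}^n\frac{\partial M_{\phi,ij}}{\partial x_k}(x)\,\big(f(x)+g\,u_\theta(x)\big)_k$. The controlled system is $\dot x=f(x)+g\,u(t)$ with input $u(t)\in\mathbb{R}^m$; closing the loop with $u=u_\theta(x)$ gives $\dot x=f(x)+g\,u_\theta(x)$. Controller: $u_\theta(x)=W_o z_N$, where $z_1=\sigma_1(W_1x+b_1)$ and $z_\ell=\sigma_\ell(W_\ell z_{\ell-1}+b_\ell)$ for $\ell=2,\dots,N$, with $N\ge1$, real weight matrices $W_o,W_1,\dots,W_N$ and bias vectors $b_1,\dots,b_N$ of compatible sizes (collected in the parameter $\theta$), and differentiable scalar activation functions $\sigma_\ell$ applied componentwise whose derivatives satisfy $0<a\le\sigma_\ell'(\cdot)<b$ for constants $a,b$. The subscript $\phi$ denotes the trainable parameters of $M_\phi$ (a ''neural contraction metric''); they are fixed here. An equilibrium $x^\star$ is exponentially stable if there exist $\delta,C,\kappa>0$ such that every solution with $\|x(0)-x^\star\|<\delta$ exists for all $t\ge0$ and satisfies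 $\|x(t)-x^\star\|\le Ce^{-\kappa t}\|x(0)-x^\star\|$. *)

(* Defs.v *)
From HB Require Import structures.
From mathcomp Require Import all_boot all_order all_algebra.
From mathcomp Require Import all_classical all_reals all_analysis.

Set Implicit Arguments.
Unset Strict Implicit.
Unset Printing Implicit Defensive.

Import Order.TTheory GRing.Theory Num.Theory.
Import numFieldNormedType.Exports.

Local Open Scope classical_set_scope.
Local Open Scope ring_scope.

Section Matrices.
Context {R : realType}.

(* The library norm on ['cV_n] is the sup norm. *)
Definition norm2 n (v : 'cV[R]_n) : R := Num.sqrt (\sum_i v i 0 ^+ 2).

(* No factor 1/2. *)
Definition Sym n (A : 'M[R]_n) : 'M[R]_n := A + A^T.

Definition sym_posdef n (A : 'M[R]_n) : Prop :=
  A^T = A /\ forall v : 'cV[R]_n, v != 0 -> 0 < (v^T *m A *m v) 0 0.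

(* Largest eigenvalue; meant for a symmetric [A] and [n > 0], where the set is
   finite and nonempty, so that the supremum is a maximum. *)
Definition lambda_max n (A : 'M[R]_n) : R := sup [set l | eigenvalue A l].

Definition mx_entry_le m n (A B : 'M[R]_(m, n)) : Prop :=
  forall i j, A i j <= B i j.

End Matrices.

Section Calculus.
Context {R : realType}.

Definition basis_vec n (k : 'I_n) : 'cV[R]_n := delta_mx k 0.

Definition partial n (V : normedModType R) (k : 'I_n) (h : 'cV[R]_n -> V)
  : 'cV[R]_n -> V := fun x => 'D_(basis_vec k) h x.

Definition Jacobian n m (h : 'cV[R]_n -> 'cV[R]_m) (x : 'cV[R]_n) : 'M[R]_(m, n) :=
  \matrix_(i, j) partial j (fun y => h y i 0 : R) x.

(* Derivative of the matrix function [M] along the vector field [F]. *)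
Definition derivative_along n (F : 'cV[R]_n -> 'cV[R]_n)
    (M : 'cV[R]_n -> 'M[R]_n) (x : 'cV[R]_n) : 'M[R]_n :=
  \matrix_(i, j) \sum_k partial k (fun y => M y i j : R) x * F x k 0.

(* C^k on an open set [O]: the partial derivatives of order at most [k] exist
   and are continuous at every point of [O]. *)
Fixpoint Ck_on n (V : normedModType R) (k : nat) (O : set 'cV[R]_n)
    (h : 'cV[R]_n -> V) : Prop :=
  (forall x, O x -> {for x, continuous h}) /\
  match k with
  | 0 => True
  | k'.+1 => forall j : 'I_n,
      (forall x, O x -> derivable h x (basis_vec j)) /\ Ck_on k' O (partial j h)
  end.

(* Smoothness on an arbitrary set [A]: [h] is C^oo on an open neighbourhood of
   [A]. A map given only on [A] is thus represented by a total function whose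
   restriction to some neighbourhood of [A] is a smooth extension of it; its
   values away from that neighbourhood are irrelevant. *)
Definition smooth_on n (V : normedModType R) (A : set 'cV[R]_n)
    (h : 'cV[R]_n -> V) : Prop :=
  exists O : set 'cV[R]_n, [/\ open O, A `<=` O & forall k, Ck_on k O h].

End Calculus.

Section Network.
Context {R : realType}.

(* The hidden part of a network on R^n whose last layer has width [k]. There is
   at least one layer, and each layer carries its own activation function. *)
Inductive hidden_layers (n : nat) : nat -> Type :=
| FirstLayer k (sigma : R -> R) (W : 'M[R]_(k, n)) (b : 'cV[R]_k) :
    hidden_layers n k
| NextLayer k l (h : hidden_layers n k)
    (sigma : R -> R) (W : 'M[R]_(l, k)) (b : 'cV[R]_l) : hidden_layers n l.

Fixpoint hidden_output n k (h : hidden_layers n k) (x : 'cV[R]_n) : 'cV[R]_k :=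
  match h with
  | FirstLayer _ sigma W b => map_mx sigma (W *m x + b)
  | NextLayer _ _ h' sigma W b =>
      map_mx sigma (W *m hidden_output h' x + b)
  end.

Definition activation_slope (a b : R) (sigma : R -> R) : Prop :=
  forall t : R, derivable sigma t 1 /\ a <= derive1 sigma t < b.

Fixpoint hidden_slopes (a b : R) n k (h : hidden_layers n k) : Prop :=
  match h with
  | FirstLayer _ sigma _ _ => activation_slope a b sigma
  | NextLayer _ _ h' sigma _ _ =>
      hidden_slopes a b h' /\ activation_slope a b sigma
  end.

Record network (n m : nat) := Network {
  last_width : nat;
  layers : hidden_layers n last_width;
  output_weights : 'M[R]_(m, last_width)
}.

Definition network_feedback n m (net : network n m) (x : 'cV[R]_n) : 'cV[R]_m :=
  output_weights net *m hidden_output (layers net) x.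

Definition network_slopes (a b : R) n m (net : network n m) : Prop :=
  hidden_slopes a b (layers net).

End Network.
Arguments network R n m : clear implicits.

Section Stability.
Context {R : realType}.

Definition time_domain (T : \bar R) : set R :=
  [set t | 0 <= t /\ (t%:E < T)%E].

(* [x] solves x' = F x on [0, T[, where [T] may be [+oo]. For continuous [F],
   continuity at 0 together with the equation on ]0, T[ amounts to the equation
   on [0, T[ with a one-sided derivative at 0. *)
Definition is_solution n (F : 'cV[R]_n -> 'cV[R]_n) (T : \bar R)
    (x : R -> 'cV[R]_n) : Prop :=
  {within time_domain T, continuous x} /\
  forall t : R, 0 < t -> (t%:E < T)%E -> is_derive t (1 : R) x (F (x t)).

(* "Every solution starting in the ball exists for all t >= 0": some solution on
   [0, +oo[ starts at the given point, and any solution on a shorter interval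
   extends to one on [0, +oo[. *)
Definition exponentially_stable_equilibrium n
    (F : 'cV[R]_n -> 'cV[R]_n) (xs : 'cV[R]_n) : Prop :=
  F xs = 0 /\
  exists delta C kappa : R, [/\ 0 < delta, 0 < C, 0 < kappa &
    forall x0 : 'cV[R]_n, norm2 (x0 - xs) < delta ->
      (exists x, is_solution F +oo x /\ x 0 = x0) /\
      forall (T : \bar R) (x : R -> 'cV[R]_n),
        (0 < T)%E -> is_solution F T x -> x 0 = x0 ->
        (exists y, is_solution F +oo y /\
                   forall t, time_domain T t -> y t = x t) /\
        (forall t, time_domain T t ->
           norm2 (x t - xs) <= C * expR (- (kappa * t)) * norm2 (x0 - xs))].

End Stability.

(* Main.v *)
(* Since [F xs = 0], the derivative of [M] along [F] vanishes at [xs], so there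
   [L <= M g Du <= U] entrywise. By Gershgorin's theorem the dominance condition
   gives [Sym (M g Du) <= - (c1 + c2) I], and the bounds defining [c1] and [c2]
   then yield the Lyapunov inequality [Sym (M DF) <= - 2 rho M] at [xs]. Hence
   [V v = v^T M v] decreases exponentially along solutions of the nonlinear system
   near [xs], and small sublevel sets of [V] trap solutions. Global existence comes
   from Picard iteration for the field composed with the retraction onto a sup-norm
   ball, and extension of partial solutions from uniqueness. *)
Require Import Defs.
From HB Require Import structures.
From mathcomp Require Import all_boot all_order all_algebra.
From mathcomp Require Import all_classical all_reals all_analysis.
From mathcomp Require Import ring lra.

Set Implicit Arguments.
Unset Strict Implicit.
Unset Printing Implicit Defensive.

Import Order.TTheory GRing.Theory Num.Theory.
Import numFieldNormedType.Exports.

Local Open Scope classical_set_scope.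
Local Open Scope ring_scope.

(** * Mean values, sup norm and bilinear forms *)

(** The activation slopes are bounded but need not be continuous, so the closed-loop field need not
    be C^1, and the two facts that the Lyapunov argument consumes have separate sources. A Lipschitz
    bound near [xs], for existence and uniqueness, combines strict differentiability of [f] with a
    global Lipschitz constant of the network obtained from the slope bound. A Frechet derivative at
    [xs], for the decay of [V], comes for the network from a chain rule through the layers; partial
    derivatives alone would not control increments in other directions. The linear inequality
    provides the rate [rho]. The Frechet remainder is allowed to consume half of it, so solutions
    decay at the rate [rho / 2]. Lipschitz, Frechet and Picard estimates use the sup norm of the
    library, while stability is stated in the Euclidean norm; quadratic forms mediate between the
    two. *)

Section MeanValue.
Context {R : realType}.

Lemma nonpos_derive_le (f df : R -> R) (a b : R) : a <= b ->
  {within `[a, b], continuous f} ->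
  (forall t, a < t -> t < b -> is_derive t (1 : R) f (df t) /\ df t <= 0) ->
  f b <= f a.
Proof.
rewrite le_eqVlt => /predU1P[->//|ab] cf dfP.
have [|c] := MVT ab _ cf (df := df).
  by move=> x; rewrite in_itv/= => /andP[ax xb]; have [] := dfP x ax xb.
rewrite in_itv/= => /andP[ac cb] fE; rewrite -subr_le0 fE.
by rewrite mulr_le0_ge0 ?subr_ge0 ?(ltW ab)//; have [] := dfP c ac cb.
Qed.

(** Both [f - g] and [- f - g] are nonincreasing. The majorant [g] is linear for Lipschitz bounds
    and exponential for the contraction of the Picard operator. *)
Lemma norm_sub_le_of_derive (f df g dg : R -> R) (a b : R) : a <= b ->
  {within `[a, b], continuous f} -> {within `[a, b], continuous g} ->
  (forall t, a < t -> t < b -> is_derive t (1 : R) f (df t) /\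
     is_derive t (1 : R) g (dg t) /\ `|df t| <= dg t) ->
  `|f b - f a| <= g b - g a.
Proof.
move=> ab cf cg fgP.
have h1 : (f - g) b <= (f - g) a.
  apply: (@nonpos_derive_le _ (fun t => df t - dg t)) => //.
    by move=> x; apply: cvgB; [exact: cf|exact: cg].
  move=> t ta tb; have [df_ [dg_]] := fgP t ta tb.
  rewrite ler_norml subr_le0 => /andP[_ ->]; split => //; exact: is_deriveB.
have h2 : (- f - g) b <= (- f - g) a.
  apply: (@nonpos_derive_le _ (fun t => - df t - dg t)) => //.
    by move=> x; apply: cvgB; [apply: cvgN; exact: cf|exact: cg].
  move=> t ta tb; have [df_ [dg_]] := fgP t ta tb.
  rewrite ler_norml => /andP[le _]; split; [exact: is_deriveB|lra].
move: h1 h2; rewrite !fctE /= => h1 h2.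
by rewrite ler_norml; lra.
Qed.

Lemma is_derive_scale (c t : R) : is_derive t (1 : R) (fun s => c * s) c.
Proof.
have {2}-> : c = c *: (1 : R) by rewrite -[RHS]/(c * 1) mulr1.
exact: (is_deriveZ (f := id)).
Qed.

End MeanValue.

Section SupNorm.
Context {R : realType}.

Lemma mx_norm_leP m n (A : 'M[R]_(m, n)) (e : R) : 0 <= e ->
  reflect (forall i j, `|A i j| <= e) (`|A| <= e).
Proof.
move=> e0; apply: (iffP idP) => [Ae i j|Ae].
  apply: le_trans Ae; rewrite [leRHS]/Num.Def.normr/= mx_normrE.
  exact: (le_bigmax _ (fun ij => `|A ij.1 ij.2|) (i, j)).
by rewrite /Num.Def.normr/= mx_normrE; apply: bigmax_le => // -[i j] _.
Qed.

Lemma norm_maxB_le (a b c : R) : `|Num.max a c - Num.max b c| <= `|a - b|.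
Proof.
have lo := lerNnormlW (lexx `|a - b|); have hi := ler_norm (a - b).
by rewrite ler_norml /Num.max; do 2 case: ltP => ?; lra.
Qed.

Lemma norm_minB_le (a b c : R) : `|Num.min a c - Num.min b c| <= `|a - b|.
Proof.
have lo := lerNnormlW (lexx `|a - b|); have hi := ler_norm (a - b).
by rewrite ler_norml /Num.min; do 2 case: ltP => ?; lra.
Qed.

Lemma mx_subE m n (A B : 'M[R]_(m, n)) i j : (A - B) i j = A i j - B i j.
Proof. by rewrite !mxE. Qed.

Lemma coord_le_norm m n (A : 'M[R]_(m, n)) i j : `|A i j| <= `|A|.
Proof. exact/(mx_norm_leP A (normr_ge0 A)). Qed.

Lemma cV_norm_leP n (v : 'cV[R]_n) (e : R) : 0 <= e ->
  reflect (forall i, `|v i 0| <= e) (`|v| <= e).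
Proof.
move=> e0; apply: (iffP (mx_norm_leP v e0)) => [h i|h i j]; first exact: h.
by rewrite ord1.
Qed.

(** A crude constant that bounds both the sup-norm operator norm of [A] and its bilinear form; its
    uses require only some finite bound. *)
Definition entry_sum m n (A : 'M[R]_(m, n)) : R := \sum_i \sum_j `|A i j|.

Lemma entry_sum_ge0 m n (A : 'M[R]_(m, n)) : 0 <= entry_sum A.
Proof. by apply: sumr_ge0 => i _; exact: sumr_ge0. Qed.

Lemma norm_mulmx_le m n (A : 'M[R]_(m, n)) (v : 'cV[R]_n) :
  `|A *m v| <= entry_sum A * `|v|.
Proof.
apply/cV_norm_leP => [|i]; first by rewrite mulr_ge0 ?entry_sum_ge0.
rewrite mxE (le_trans (ler_norm_sum _ _ _))//.
apply: (@le_trans _ _ (\sum_j `|A i j| * `|v|)).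
  by apply: ler_sum => j _; rewrite normrM ler_wpM2l// coord_le_norm.
rewrite -mulr_suml ler_wpM2r// /entry_sum (bigD1 i)//= lerDl.
by apply: sumr_ge0 => k _; exact: sumr_ge0.
Qed.

Definition bform n (A : 'M[R]_n) (v w : 'cV[R]_n) : R := (v^T *m A *m w) 0 0.

Definition sqnorm n (v : 'cV[R]_n) : R := \sum_i v i 0 ^+ 2.

Lemma bformE n (A : 'M[R]_n) v w :
  bform A v w = \sum_i \sum_j v i 0 * A i j * w j 0.
Proof.
rewrite /bform -mulmxA mxE; apply: eq_bigr => i _.
rewrite !mxE mulr_sumr; apply: eq_bigr => j _.
by rewrite mulrA.
Qed.

Lemma sqnorm_ge0 n (v : 'cV[R]_n) : 0 <= sqnorm v.
Proof. by apply: sumr_ge0 => i _; exact: sqr_ge0. Qed.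

Lemma sqnorm_eq0 n (v : 'cV[R]_n) : sqnorm v = 0 -> v = 0.
Proof.
move=> /psumr_eq0P v0; apply/matrixP => i j; rewrite ord1 mxE.
by apply/eqP; rewrite -sqrf_eq0 v0// => k _; exact: sqr_ge0.
Qed.

(** The bridge between the sup norm and the Euclidean norm. Comparisons go in this direction only,
    so they bring in no factor depending on the dimension. *)
Lemma norm_le_sqnorm n (v : 'cV[R]_n) : `|v| ^+ 2 <= sqnorm v.
Proof.
rewrite -(sqr_sqrtr (sqnorm_ge0 v)) ler_sqr ?nnegrE ?sqrtr_ge0//.
apply/cV_norm_leP => [|i]; first exact: sqrtr_ge0.
rewrite -sqrtr_sqr ler_wsqrtr// /sqnorm (bigD1 i)//= lerDl.
by apply: sumr_ge0 => j _; exact: sqr_ge0.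
Qed.

Lemma norm2_sqr n (v : 'cV[R]_n) : norm2 v ^+ 2 = sqnorm v.
Proof. by rewrite sqr_sqrtr// sqnorm_ge0. Qed.

Lemma norm_bform_le n (A : 'M[R]_n) (v w : 'cV[R]_n) :
  `|bform A v w| <= entry_sum A * (`|v| * `|w|).
Proof.
rewrite bformE mulr_suml (le_trans (ler_norm_sum _ _ _))//.
apply: ler_sum => i _; rewrite mulr_suml (le_trans (ler_norm_sum _ _ _))//.
apply: ler_sum => j _; rewrite !normrM -mulrA mulrCA ler_wpM2l//.
by rewrite ler_pM// coord_le_norm.
Qed.

Lemma bformDr n (A : 'M[R]_n) v w w' :
  bform A v (w + w') = bform A v w + bform A v w'.
Proof. by rewrite /bform mulmxDr mxE. Qed.

Lemma bformDl n (A : 'M[R]_n) v v' w :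
  bform A (v + v') w = bform A v w + bform A v' w.
Proof. by rewrite /bform linearD/= !mulmxDl mxE. Qed.

Lemma bformZl n (A : 'M[R]_n) c v w : bform A (c *: v) w = c * bform A v w.
Proof. by rewrite /bform linearZ/= -!scalemxAl mxE. Qed.

Lemma bformZr n (A : 'M[R]_n) c v w : bform A v (c *: w) = c * bform A v w.
Proof. by rewrite /bform -scalemxAr mxE. Qed.

Lemma bform0r n (A : 'M[R]_n) v : bform A v 0 = 0.
Proof. by rewrite /bform mulmx0 mxE. Qed.

Lemma bformC n (A : 'M[R]_n) v w : bform A v w = bform A^T w v.
Proof.
rewrite /bform; have -> : (v^T *m A *m w) 0 0 = (v^T *m A *m w)^T 0 0.
  by rewrite [RHS]mxE.
by rewrite !trmx_mul trmxK mulmxA.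
Qed.

Lemma bformDm n (A B : 'M[R]_n) v w : bform (A + B) v w = bform A v w + bform B v w.
Proof. by rewrite /bform mulmxDr mulmxDl mxE. Qed.

Lemma bformZm n c (A : 'M[R]_n) v w : bform (c *: A) v w = c * bform A v w.
Proof. by rewrite /bform -scalemxAr -scalemxAl mxE. Qed.

Lemma bform_mul n (A B : 'M[R]_n) v w : bform A v (B *m w) = bform (A *m B) v w.
Proof. by rewrite /bform !mulmxA. Qed.

Lemma bform_Sym n (A : 'M[R]_n) v : bform (Sym A) v v = 2 * bform A v v.
Proof. by rewrite bformDm -bformC mulr2n mulrDl mul1r. Qed.

Lemma bform1 n (v : 'cV[R]_n) : bform 1%:M v v = sqnorm v.
Proof.
by rewrite /bform mulmx1 mxE; apply: eq_bigr => i _; rewrite mxE expr2.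
Qed.

Lemma sqnorm0 n : sqnorm (0 : 'cV[R]_n) = 0.
Proof. by rewrite -bform1 bform0r. Qed.

End SupNorm.

(** * Rayleigh quotients *)

Section Rayleigh.
Context {R : realType}.

Lemma continuous_sum (T : topologicalType) (I : finType) (F : I -> T -> R) :
  (forall i, continuous (F i)) -> continuous (fun x => \sum_i F i x).
Proof.
move=> cF x; rewrite /continuous_at.
by apply: cvg_big => [|i _]; [exact: add_continuous|exact: cF].
Qed.

Lemma continuous_bform (T : topologicalType) n (A : 'M[R]_n) (z : T -> 'cV[R]_n) :
  (forall i, continuous (fun s => z s i 0)) ->
  continuous (fun s => bform A (z s) (z s)).
Proof.
move=> cz; rewrite (_ : (fun s => _) =
    (fun s => \sum_i \sum_j z s i 0 * A i j * z s j 0)); last first.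
  by apply/funext => s; rewrite bformE.
apply: continuous_sum => i; apply: continuous_sum => j s.
apply: (@continuousM R _ (fun s => z s i 0 * A i j)); last exact: cz.
apply: (@continuousM R _ (fun s => z s i 0)); last exact: cst_continuous.
exact: cz.
Qed.

Lemma continuous_bform_tr n (A : 'M[R]_n) :
  continuous (fun w : 'rV[R]_n => bform A w^T w^T).
Proof.
apply: continuous_bform => i.
have -> : (fun w : 'rV[R]_n => w^T i 0) = (fun w => w 0 i).
  by apply/funext => w; rewrite mxE.
exact: coord_continuous.
Qed.

(* Row vectors, as compactness in the library is stated for them. *)
Definition unit_sphere n : set 'rV[R]_n := [set w | sqnorm w^T = 1].
Arguments unit_sphere n _ : clear implicits.

Lemma compact_sphere n : compact (unit_sphere n).
Proof.
apply: bounded_closed_compact; last first.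
  rewrite (_ : unit_sphere n = (fun w => bform 1%:M w^T w^T) @^-1` [set 1]); last first.
    by apply/seteqP; split => w /=; rewrite bform1.
  apply: closed_comp => [w _|]; first exact: continuous_bform_tr.
  exact: closed_eq.
exists 1; split => // e e1 w /= w1.
apply/mx_norm_leP => [|i j]; first by rewrite (le_trans _ (ltW e1)).
rewrite ord1; have -> : w 0 j = w^T j 0 by rewrite [RHS]mxE.
rewrite (le_trans _ (ltW e1))// (le_trans (coord_le_norm w^T j 0))//.
by rewrite -(@ler_pXn2r _ 2)// ?nnegrE// expr1n -w1 norm_le_sqnorm.
Qed.

Lemma sphere_normalize n (v : 'cV[R]_n) : v != 0 ->
  exists c w, [/\ 0 < c, unit_sphere n w, v = c *: w^T & c ^+ 2 = sqnorm v].
Proof.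
move=> v0; have nv : 0 < norm2 v.
  rewrite sqrtr_gt0 lt_neqAle sqnorm_ge0 andbT eq_sym.
  by apply: contra v0 => /eqP/sqnorm_eq0 ->.
exists (norm2 v), ((norm2 v)^-1 *: v)^T; split => //.
- rewrite /unit_sphere/= trmxK -bform1 bformZl bformZr bform1 -norm2_sqr.
  by rewrite mulrA -invfM -expr2 mulVf// expf_neq0// gt_eqF.
- by rewrite trmxK scalerA divff ?scale1r// gt_eqF.
- exact: norm2_sqr.
Qed.

Lemma posdef_lower_bound n (P : 'M[R]_n) : sym_posdef P ->
  exists2 al, 0 < al & forall v : 'cV[R]_n, al * sqnorm v <= bform P v v.
Proof.
move=> [_ Ppos]; have [[w0 w0S]|S0] := pselect (unit_sphere n !=set0).
  have [|w wS wmin] := compact_EVT_min _ (@compact_sphere n)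
    (continuous_subspaceT (@continuous_bform_tr n P)); first by exists w0.
  rewrite inE in wS.
  exists (bform P w^T w^T) => [|v].
    apply: Ppos; apply/eqP => w_0; move: wS; rewrite /unit_sphere/= w_0 sqnorm0.
    by move/eqP; rewrite eq_sym oner_eq0.
  have [->|/sphere_normalize[c [z [c0 zS -> <-]]]] := eqVneq v 0.
    by rewrite bform0r sqnorm0 mulr0.
  rewrite bformZl bformZr mulrA -expr2 mulrC ler_pM2l ?exprn_gt0//.
  by apply: wmin; rewrite inE.
(* The sphere is empty: the only vector is 0, and any positive constant does. *)
exists 1 => // v; have [->|/sphere_normalize[c [z [_ zS _ _]]]] := eqVneq v 0.
  by rewrite bform0r sqnorm0 mulr0.
by case: S0; exists z.
Qed.

Lemma psd_kernel n (A : 'M[R]_n) v : A^T = A ->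
  (forall w, 0 <= bform A w w) -> bform A v v = 0 -> A *m v = 0.
Proof.
move=> AT Apos Av0.
set w := A *m v.
have vw : bform A v w = sqnorm w.
  by rewrite bformC AT -bform1 /w [RHS]bform_mul mul1mx.
have wv : bform A w v = sqnorm w by rewrite bformC AT.
apply: sqnorm_eq0; apply/eqP; rewrite eq_le sqnorm_ge0 andbT.
(* Otherwise the form would be negative at [v - t *: A *m v] for small [t > 0]. *)
have key t : 0 <= t ^+ 2 * bform A w w - 2 * t * sqnorm w.
  have := Apos (v - t *: w); rewrite -scaleNr !(bformDl, bformDr, bformZl, bformZr).
  by rewrite Av0 vw wv; set x := bform _ _ _; set y := sqnorm w; nra.
rewrite leNgt; apply/negP => w0.
have B0 := Apos w.
(* The quadratic in [t] is minimal at [sqnorm w / bform A w w]; adding 1 to the denominator avoids a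
   division by zero and still gives a negative value. *)
have := key (sqnorm w / (1 + bform A w w)).
set s := sqnorm w in w0 *; set B := bform A w w in B0 *.
have B1 : 0 < 1 + B by lra.
have -> : (s / (1 + B)) ^+ 2 * B - 2 * (s / (1 + B)) * s =
   s ^+ 2 / (1 + B) ^+ 2 * (B - 2 * (1 + B)).
  by field; rewrite gt_eqF.
rewrite pmulr_rge0; first lra.
by rewrite divr_gt0// exprn_gt0.
Qed.

(** [lambda_max] is a supremum of eigenvalues. The maximum [mu] of the form on the compact unit
    sphere bounds the form by homogeneity, and it is itself an eigenvalue, hence at most that
    supremum. *)
Lemma bform_le_lambda_max n (S : 'M[R]_n) v : S^T = S ->
  bform S v v <= lambda_max S * sqnorm v.
Proof.
move=> ST.
have [->|v0] := eqVneq v 0.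
  by rewrite bform0r sqnorm0 mulr0.
have [c [z [c0 zS -> <-]]] := sphere_normalize v0.
rewrite bformZl bformZr mulrA -expr2 mulrC ler_pM2r ?exprn_gt0//.
have [|w wS wmax] := compact_EVT_max _ (@compact_sphere n)
    (continuous_subspaceT (@continuous_bform_tr n S)); first by exists z.
rewrite inE in wS; set mu := bform S w^T w^T in wmax.
apply: (@le_trans _ _ mu); first by apply: wmax; rewrite inE.
have ray x : bform S x x <= mu * sqnorm x.
  have [->|/sphere_normalize[d [y [d0 yS -> <-]]]] := eqVneq x 0.
    by rewrite bform0r sqnorm0 mulr0.
  rewrite bformZl bformZr mulrA -expr2 mulrC ler_pM2r ?exprn_gt0//.
  by apply: wmax; rewrite inE.
(* The set of eigenvalues must be shown bounded, since otherwise [sup] would be a default value. *)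
have bnd l : eigenvalue S l -> l <= mu.
  move=> /eigenvalueP[x xS x0].
  have [d [y [d0 yS xE _]]] : exists c w, [/\ 0 < c, unit_sphere n w, x^T = c *: w^T
      & c ^+ 2 = sqnorm x^T].
    by apply: sphere_normalize; rewrite -(inj_eq trmx_inj) trmxK trmx0.
  have := ray x^T.
  rewrite /bform trmxK xS -scalemxAl mxE.
  have -> : (x *m x^T) 0 0 = sqnorm x^T by rewrite -bform1 /bform trmxK mulmx1.
  rewrite ler_pM2r// xE -bform1 bformZl bformZr bform1.
  by move: yS => /= ->; rewrite mulr1 mulr_gt0.
apply: ub_le_sup; first by exists mu => l /bnd.
apply/eigenvalueP; exists w.
  (* A maximizer of the Rayleigh quotient is an eigenvector. *)
  have : (mu%:M - S) *m w^T = 0.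
    apply: psd_kernel.
    - by rewrite linearB/= tr_scalar_mx ST.
    - move=> x; rewrite bformDm -scaleN1r -scalemx1 !bformZm bform1 mulN1r.
      by rewrite subr_ge0.
    - rewrite bformDm -scaleN1r -scalemx1 !bformZm bform1 mulN1r.
      by move: (wS); rewrite /unit_sphere/= => ->; rewrite mulr1 subrr.
  rewrite mulmxBl mul_scalar_mx => /eqP; rewrite subr_eq0 => /eqP/(congr1 trmx).
  by rewrite linearZ/= trmx_mul !trmxK ST.
apply/eqP => w_0; move: wS; rewrite /unit_sphere/= w_0 trmx0 sqnorm0.
by move/eqP; rewrite eq_sym oner_eq0.
Qed.

End Rayleigh.

(** * Gershgorin's bound and Frechet derivatives *)

Section Gershgorin.
Context {R : realType}.

(** Gershgorin's bound, directly for the form: [2 * |x * y| <= x ^+ 2 + y ^+ 2] splits each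
    off-diagonal term into two halves, and the symmetry of [S] lets the half belonging to the column
    be counted in the row. *)
Lemma bform_le_of_diag_dominance n (S : 'M[R]_n) (c : R) v : S^T = S ->
  (forall i, S i i + \sum_(j | j != i) `|S i j| <= c) ->
  bform S v v <= c * sqnorm v.
Proof.
move=> ST dom; rewrite bformE /sqnorm mulr_sumr.
pose off i j := `|S i j| * ((v i 0 ^+ 2 + v j 0 ^+ 2) / 2).
have Ssym i j : S i j = S j i by rewrite -[in LHS]ST mxE.
apply: (@le_trans _ _
  (\sum_i (S i i * v i 0 ^+ 2 + \sum_(j | j != i) off i j))).
  apply: ler_sum => i _; rewrite (bigD1 i)//= lerD//.
    by rewrite mulrAC mulrC expr2.
  apply: ler_sum => j _; apply: le_trans (ler_norm _) _.
  rewrite /off [v i 0 * _]mulrC -mulrA normrM ler_wpM2l//.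
  rewrite ler_norml; have := sqr_ge0 (v i 0 + v j 0).
  by have := sqr_ge0 (v i 0 - v j 0); nra.
have -> : \sum_i (S i i * v i 0 ^+ 2 + \sum_(j | j != i) off i j) =
    \sum_i (S i i + \sum_(j | j != i) `|S i j|) * v i 0 ^+ 2.
  pose half i j := `|S i j| * (v i 0 ^+ 2 / 2).
  have offE i j : off i j = half i j + half j i.
    by rewrite /off /half (Ssym j i) -mulrDr mulrDl.
  transitivity (\sum_i S i i * v i 0 ^+ 2 +
      (\sum_i \sum_(j | j != i) half i j + \sum_i \sum_(j | j != i) half i j)).
    rewrite big_split/=; congr (_ + _).
    under eq_bigr do (under eq_bigr do rewrite offE; rewrite big_split/=).
    rewrite big_split/=; congr (_ + _).
    rewrite (exchange_big_dep xpredT)//=; apply: eq_bigr => i _.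
    by apply: eq_bigl => j; rewrite eq_sym.
  rewrite -!big_split/=; apply: eq_bigr => i _.
  rewrite mulrDl; congr (_ + _); rewrite -big_split/= mulr_suml.
  by apply: eq_bigr => j _; rewrite /half -mulrDr -splitr.
by apply: ler_sum => i _; rewrite ler_wpM2r// sqr_ge0.
Qed.

End Gershgorin.

Section Frechet.
Context {R : realType}.

Definition lipschitz_map n m (K : R) (h : 'cV[R]_n -> 'cV[R]_m) : Prop :=
  forall x y, `|h x - h y| <= K * `|x - y|.

(** The remainder estimate is multiplied out, so that [y = x] needs no exception and no division by
    a norm occurs. *)
Definition frechet_at n m (h : 'cV[R]_n -> 'cV[R]_m) (x : 'cV[R]_n)
    (D : 'M[R]_(m, n)) : Prop :=
  forall e : R, 0 < e ->
    \forall y \near x, `|h y - h x - D *m (y - x)| <= e * `|y - x|.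

Lemma lipschitz_continuous n m K (h : 'cV[R]_n -> 'cV[R]_m) :
  lipschitz_map K h -> continuous h.
Proof.
move=> hK x; apply/(@cvgrPdist_le _ _ _ (nbhs x)) => e e0.
(* The sign of [K] is unknown, and a positive number is needed to divide by. *)
have K0 : 0 < `|K| + 1 by rewrite ltr_wpDl.
have e1 : 0 < e / (`|K| + 1) by rewrite divr_gt0.
near=> y; have : ball x (e / (`|K| + 1)) y by near: y; exact: nbhsx_ballx.
rewrite -ball_normE/= => /ltW; rewrite ler_pdivlMr// => xy.
apply: le_trans (hK _ _) _; apply: le_trans xy; rewrite mulrC ler_wpM2l//.
by rewrite (le_trans (ler_norm K))// lerDl.
Unshelve. all: by end_near. Qed.

(** Restricting the remainder estimate to the line through [x] along a basis vector gives the
    partial derivatives. This identifies the derivative built by the chain rule with the [Jacobian]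
    that the entrywise bounds speak of. *)
Lemma frechet_Jacobian n m (h : 'cV[R]_n -> 'cV[R]_m) x D :
  frechet_at h x D -> Jacobian h x = D.
Proof.
move=> hD; apply/matrixP => i j; rewrite mxE /partial /derive.
apply: cvg_lim => //; apply/cvgrPdist_le => /= e e0.
have cv : (fun t : R => t *: (basis_vec j : 'cV[R]_n) + x) @ 0^' --> x.
  have -> : (fun t : R => t *: (basis_vec j : 'cV[R]_n) + x) =
      (fun t : R => t *: (basis_vec j : 'cV[R]_n)) + cst x by [].
  rewrite -[X in _ --> X]add0r; apply: cvgD; last exact: cvg_cst.
  rewrite -(scale0r (basis_vec j)); apply: cvg_trans (@scalel_continuous _ _ _ _).
  by apply: cvg_app; exact: nbhs_dnbhs.
have := cv _ (hD _ e0); rewrite /= => hd.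
near=> t.
have t0 : t != 0 by near: t; exact: nbhs_dnbhs_neq.
have : `|h (t *: basis_vec j + x) - h x - D *m (t *: basis_vec j + x - x)|
    <= e * `|t *: basis_vec j + x - x| by near: t.
rewrite addrK -scalemxAr normrZ => /(le_trans (coord_le_norm _ i 0)).
have -> : (h (t *: basis_vec j + x) - h x - t *: (D *m basis_vec j)) i 0 =
    h (t *: basis_vec j + x) i 0 - h x i 0 - t * D i j.
  rewrite !mxE (bigD1 j)//= !mxE !eqxx mulr1.
 rewrite big1 ?addr0// => k kj.
  by rewrite mxE (negbTE kj) mulr0.
have b1 : `|basis_vec j : 'cV[R]_n| <= 1.
  by apply/mx_norm_leP => // k l; rewrite mxE; case: (_ && _); rewrite ?normr1 ?normr0.
move=> le1.
have {le1} : `|h (t *: basis_vec j + x) i 0 - h x i 0 - t * D i j| <= e * `|t|.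
  apply: le_trans le1 _; rewrite ler_pM2l// ler_piMr//.
rewrite distrC => le1.
have -> : D i j - t^-1 *: (h (t *: basis_vec j + x) i 0 - h x i 0) =
   t^-1 * (t * D i j - (h (t *: basis_vec j + x) i 0 - h x i 0)).
  by rewrite mulrBr mulKf.
by rewrite normrM normfV ler_pdivrMl ?normr_gt0// [leRHS]mulrC.
Unshelve. all: by end_near. Qed.

Lemma frechet_add n m (h k : 'cV[R]_n -> 'cV[R]_m) x D E :
  frechet_at h x D -> frechet_at k x E ->
  frechet_at (fun y => h y + k y) x (D + E).
Proof.
move=> hD kE e e0; have e2 : 0 < e / 2 by rewrite divr_gt0.
near=> y.
have -> : h y + k y - (h x + k x) - (D + E) *m (y - x) =
    (h y - h x - D *m (y - x)) + (k y - k x - E *m (y - x)).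
  by rewrite mulmxDl !opprD; apply/matrixP => i j; rewrite !mxE; ring.
rewrite (splitr e) mulrDl (le_trans (ler_normD _ _))// lerD//; near: y.
  exact: hD.
exact: kE.
Unshelve. all: by end_near. Qed.

Lemma frechet_affine n m l (W : 'M[R]_(l, m)) (b : 'cV[R]_l)
    (h : 'cV[R]_n -> 'cV[R]_m) x D :
  frechet_at h x D -> frechet_at (fun y => W *m h y + b) x (W *m D).
Proof.
move=> hD e e0; have W0 : 0 < entry_sum W + 1 by rewrite ltr_wpDl// entry_sum_ge0.
have e2 : 0 < e / (entry_sum W + 1) by rewrite divr_gt0.
near=> y.
have -> : W *m h y + b - (W *m h x + b) - W *m D *m (y - x) =
    W *m (h y - h x - D *m (y - x)).
  by rewrite opprD addrACA subrr addr0 -mulmxA -!mulmxBr.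
have : `|h y - h x - D *m (y - x)| <= e / (entry_sum W + 1) * `|y - x|.
  by near: y; exact: hD.
rewrite mulrAC ler_pdivlMr// => le1.
apply: le_trans (norm_mulmx_le _ _) _; apply: le_trans le1.
by rewrite mulrC ler_wpM2l// lerDl.
Unshelve. all: by end_near. Qed.

Lemma lipschitz_affine n m l (W : 'M[R]_(l, m)) (b : 'cV[R]_l) K
    (h : 'cV[R]_n -> 'cV[R]_m) :
  lipschitz_map K h -> lipschitz_map (entry_sum W * K) (fun y => W *m h y + b).
Proof.
move=> hK x y; rewrite opprD addrACA subrr addr0 -mulmxBr.
rewrite (le_trans (norm_mulmx_le _ _))// -mulrA ler_wpM2l// entry_sum_ge0//.
Qed.

End Frechet.

(** * Derivatives of networks *)

Section NetworkCalculus.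
Context {R : realType}.

Lemma activation_lipschitz (a b : R) sigma : 0 < a -> activation_slope a b sigma ->
  forall s t, `|sigma s - sigma t| <= b * `|s - t|.
Proof.
move=> a0 sl; have slD (t : R) : is_derive t (1 : R) sigma (derive1 sigma t).
  by have [dt _] := sl t; rewrite derive1E; split.
have wlog_le s t : s <= t -> `|sigma t - sigma s| <= b * `|t - s|.
  move=> st; rewrite (ger0_norm (x := t - s)) ?subr_ge0//.
  rewrite mulrBr; apply: (@norm_sub_le_of_derive _ _ (derive1 sigma)
      ( *%R b) (cst b)) => //.
  - apply: continuous_subspaceT => x; apply: differentiable_continuous.
    by apply/derivable1_diffP; have [] := sl x.
  - by apply: continuous_subspaceT; exact: mulrl_continuous.
  move=> x _ _; split; first exact: slD.
  have [_ /andP[lo hi]] := sl x; split; last first.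
    by rewrite ger0_norm ?(ltW hi)// (le_trans (ltW a0)).
  exact: is_derive_scale.
move=> s t; have [/wlog_le|/ltW/wlog_le//] := leP s t.
by rewrite distrC (distrC s).
Qed.

Lemma activation_frechet (sigma : R -> R) (t e : R) : derivable sigma t 1 ->
  0 < e -> \forall s \near t,
    `|sigma s - sigma t - derive1 sigma t * (s - t)| <= e * `|s - t|.
Proof.
move=> dt e0.
have := dt; rewrite /derivable => /cvgrPdist_le /(_ e e0) hd.
have hd' : \forall d \near (0 : R)^',
    `|derive1 sigma t - d^-1 * (sigma (d + t) - sigma t)| <= e.
  near=> d; rewrite derive1E.
  have -> : d + t = d *: (1 : R) + t by rewrite -[d *: _]/(d * 1) mulr1.
  by near: d; exact: hd.
have /nbhs_ballP[r /= r0 hr] : nbhs (0 : R)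
    [set d | d != 0 -> `|derive1 sigma t - d^-1 * (sigma (d + t) - sigma t)| <= e].
  exact: hd'.
near=> s.
have [->|st] := eqVneq s t; first by rewrite !subrr mulr0 subrr normr0 mulr0.
have := hr (s - t); rewrite /ball/= sub0r normrN subrK subr_eq0 => H.
have {H} : `|derive1 sigma t - (s - t)^-1 * (sigma s - sigma t)| <= e.
  apply: H => //; near: s; apply/nbhs_ballP; exists r.
have st0 : 0 < `|s - t| by rewrite normr_gt0 subr_eq0.
rewrite -(ler_pM2r st0) -normrM; apply: le_trans.
rewrite distrC le_eqVlt; apply/orP; left; apply/eqP; congr `|_|.
by rewrite mulrBl [_^-1 * _]mulrC mulfVK// subr_eq0.
Unshelve. all: by end_near. Qed.

Lemma lipschitz_activation n m (a b K : R) sigma (k : 'cV[R]_n -> 'cV[R]_m) :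
  0 < a -> 0 <= b -> activation_slope a b sigma -> lipschitz_map K k ->
  lipschitz_map (b * K) (fun y => map_mx sigma (k y)).
Proof.
move=> a0 b0 sl kK x y.
have h0 : 0 <= K * `|x - y| by apply: le_trans (kK x y).
apply/cV_norm_leP => [|i]; first by rewrite -mulrA mulr_ge0.
rewrite !mxE (le_trans (activation_lipschitz a0 sl _ _))// -mulrA ler_wpM2l//.
by rewrite (le_trans _ (kK x y))//; have := coord_le_norm (k x - k y) i 0; rewrite !mxE.
Qed.

(** The error has two parts. The remainder of [sigma] is small relative to the increment of [k],
    which the Lipschitz bound compares with [y - x]; the remainder of [k] is multiplied by a slope
    below [b]. Each part receives [e / 2]. *)
Lemma frechet_activation n m (a b K : R) sigma (k : 'cV[R]_n -> 'cV[R]_m) x D :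
  0 < a -> 0 <= b -> activation_slope a b sigma -> lipschitz_map K k ->
  frechet_at k x D ->
  frechet_at (fun y => map_mx sigma (k y)) x
    (\matrix_(i, j) (derive1 sigma (k x i 0) * D i j)).
Proof.
move=> a0 b0 sl kK kD e e0.
have K0 : 0 < `|K| + 1 by rewrite ltr_wpDl.
have b1 : 0 < b + 1 by rewrite ltr_wpDl.
have e1 : 0 < e / 2 / (`|K| + 1) by rewrite !divr_gt0.
have e2 : 0 < e / 2 / (b + 1) by rewrite !divr_gt0.
near=> y.
apply/cV_norm_leP => [|i]; first by rewrite mulr_ge0// ltW.
have -> : (map_mx sigma (k y) - map_mx sigma (k x) -
    (\matrix_(i, j) (derive1 sigma (k x i 0) * D i j)) *m (y - x)) i 0 =
  (sigma (k y i 0) - sigma (k x i 0) - derive1 sigma (k x i 0) * (k y i 0 - k x i 0))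
  + derive1 sigma (k x i 0) * (k y - k x - D *m (y - x)) i 0.
  have E1 : ((\matrix_(i, j) (derive1 sigma (k x i 0) * D i j)) *m (y - x)) i 0 =
      derive1 sigma (k x i 0) * (D *m (y - x)) i 0.
    by rewrite !mxE mulr_sumr; apply: eq_bigr => j _; rewrite !mxE mulrA.
  have E3 (A B C : 'cV[R]_m) : (A - B - C) i 0 = A i 0 - B i 0 - C i 0.
    by rewrite !mxE.
  rewrite !E3 E1 [map_mx _ (k y) i 0]mxE [map_mx _ (k x) i 0]mxE; ring.
rewrite (splitr e) mulrDl (le_trans (ler_normD _ _))// lerD//.
  have h1 : `|sigma (k y i 0) - sigma (k x i 0) -
      derive1 sigma (k x i 0) * (k y i 0 - k x i 0)|
     <= e / 2 / (`|K| + 1) * `|k y i 0 - k x i 0|.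
    (* There are finitely many components, so one neighbourhood serves all of them. *)
    move: i; near: y; apply: filter_forall => i.
    have /(_ _ e1)/= := @activation_frechet sigma (k x i 0) _ (sl (k x i 0)).1.
    have /cvg_comp := lipschitz_continuous kK (x := x).
    move=> /(_ _ _ _ (@coord_continuous _ _ _ i 0 _)); exact.
  apply: le_trans h1 _; rewrite mulrAC ler_pdivrMr// -!mulrA ler_pM2l// ler_pM2l//.
  have := coord_le_norm (k y - k x) i 0; rewrite !mxE => /le_trans; apply.
  apply: le_trans (kK y x) _; rewrite mulrC ler_wpM2l//.
  by rewrite (le_trans (ler_norm K))// lerDl.
have h2 : `|k y - k x - D *m (y - x)| <= e / 2 / (b + 1) * `|y - x|.
  by near: y; exact: kD.
have [_ /andP[lo hi]] := sl (k x i 0).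
rewrite normrM; apply: (@le_trans _ _ ((b + 1) * `|k y - k x - D *m (y - x)|)).
  rewrite ler_pM// ?coord_le_norm// ger0_norm ?(le_trans (ltW a0))//.
  by rewrite (le_trans (ltW hi))// lerDl.
by move: h2; rewrite mulrAC ler_pdivlMr// mulrC.
Unshelve. all: by end_near. Qed.

Lemma frechet_id n (x : 'cV[R]_n) : frechet_at id x 1%:M.
Proof.
move=> e e0; near=> y; rewrite mul1mx subrr normr0 mulr_ge0//; exact: ltW.
Unshelve. all: by end_near. Qed.

(** Lipschitz continuity and differentiability go through one induction, because the chain rule at
    an activation uses both properties of the preceding layers. *)
Lemma hidden_output_frechet (a b : R) n k (h : hidden_layers n k) :
  0 < a -> 0 <= b -> hidden_slopes a b h ->
  exists2 K, lipschitz_map K (hidden_output h) &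
    forall x, exists D, frechet_at (hidden_output h) x D.
Proof.
move=> a0 b0; elim: h => [{}k sigma W c sl|{}k l h IH sigma W c [slh sl]]/=.
  have id1 : lipschitz_map 1 (@id 'cV[R]_n) by move=> x y; rewrite mul1r.
  have aff := lipschitz_affine W c id1.
  eexists; first exact: lipschitz_activation sl aff.
  move=> x; eexists; apply: (frechet_activation a0 b0 sl aff).
  exact: (frechet_affine _ _ (@frechet_id _ x)).
have [K hK hD] := IH slh; have aff := lipschitz_affine W c hK.
eexists; first exact: lipschitz_activation sl aff.
move=> x; have [D xD] := hD x; eexists; apply: (frechet_activation a0 b0 sl aff).
exact: (frechet_affine _ _ xD).
Qed.

Lemma network_frechet (a b : R) n m (net : network R n m) x :
  0 < a -> network_slopes a b net ->
  exists2 K, lipschitz_map K (network_feedback net) &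
    frechet_at (network_feedback net) x (Jacobian (network_feedback net) x).
Proof.
(* The sign of [b] is read off one slope, [0 < a <= derive1 sigma 0 < b]; a network always has a
   first layer to supply [sigma]. *)
move=> a0 sl; have b0 : 0 <= b.
  rewrite /network_slopes in sl.
  have [c /(_ 0)[_ /andP[lo hi]]] : exists sigma, activation_slope a b sigma.
    by case: (layers net) sl => [k s W c sl|k l h s W c [_ sl]]; exists s.
  by rewrite (le_trans (ltW a0))// (le_trans lo)// ltW.
have [K hK hD] := hidden_output_frechet a0 b0 sl.
have E : network_feedback net =
    (fun y => output_weights net *m hidden_output (layers net) y + 0).
  by apply/funext => y; rewrite addr0.
exists (entry_sum (output_weights net) * K); first by rewrite E; exact: lipschitz_affine.
have [D xD] := hD x; have fr := frechet_affine (output_weights net) 0 xD.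
by rewrite E (frechet_Jacobian fr).
Qed.

End NetworkCalculus.

(** * Strict differentiability of smooth maps *)

Section StrictDifferentiability.
Context {R : realType}.

Lemma is_derive_along n (h : 'cV[R]_n -> R) (p v : 'cV[R]_n) (t : R) :
  derivable h (t *: v + p) v ->
  is_derive t (1 : R) (fun s => h (s *: v + p)) ('D_v h (t *: v + p)).
Proof.
have E : (fun d : R => d^-1 *: ((h \o shift (t *: v + p)) (d *: v) - h (t *: v + p))) =
   (fun d : R => d^-1 *: (((fun s => h (s *: v + p)) \o shift t) (d *: (1 : R))
      - h (t *: v + p))).
  apply/funext => d /=; rewrite -[d%:A]/(d * 1) mulr1.
  by rewrite scalerDl addrA.
by rewrite /derivable /derive => dh; split; rewrite /derivable /derive -E.
Qed.

(** The disjunction describes the segment between [0] and [s] for either sign of [s]. On it, [h]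
    minus the linear function of slope [c] has a derivative of size at most [e]. *)
Lemma partial_increment_le n (h : 'cV[R]_n -> R) k (p : 'cV[R]_n) (c e s : R) :
  (forall t, 0 <= t <= s \/ s <= t <= 0 ->
     derivable h (t *: basis_vec k + p) (basis_vec k) /\
     `|partial k h (t *: basis_vec k + p) - c| <= e) ->
  `|h (s *: basis_vec k + p) - h p - c * s| <= e * `|s|.
Proof.
move=> hd; set phi := fun t => h (t *: basis_vec k + p).
have dphi t : 0 <= t <= s \/ s <= t <= 0 ->
    is_derive t (1 : R) phi (partial k h (t *: basis_vec k + p)).
  by move=> /hd[dh _]; exact: is_derive_along.
pose psi t := phi t - c * t.
have dpsi t : 0 <= t <= s \/ s <= t <= 0 ->
    is_derive t (1 : R) psi (partial k h (t *: basis_vec k + p) - c).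
  by move=> /dphi dt; apply: is_deriveB; exact: is_derive_scale.
have cont a b : (forall t, t \in `[a, b] -> 0 <= t <= s \/ s <= t <= 0) ->
    {within `[a, b], continuous psi}.
  move=> ab; apply: derivable_within_continuous => x /ab/dpsi dx.
  exact: (@ex_derive _ _ _ _ _ _ _ dx).
have lin a b : {within `[a, b], continuous ( *%R e)}.
  by apply: continuous_subspaceT; exact: mulrl_continuous.
have dlin (t : R) : is_derive t (1 : R) ( *%R e) e by exact: is_derive_scale.
have phi0 : phi 0 = h p by rewrite /phi scale0r add0r.
have -> : h (s *: basis_vec k + p) - h p - c * s = psi s - psi 0.
  by rewrite /psi phi0 /phi mulr0 subr0 addrAC.
have [s0|/ltW s0] := leP 0 s.
  rewrite (ger0_norm s0) -[e * s]subr0 -[X in _ <= _ - X](mulr0 e).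
  apply: (@norm_sub_le_of_derive _ _ (fun t => partial k h (t *: basis_vec k + p) - c)
    ( *%R e) (cst e)) => //.
    by apply: cont => t; rewrite in_itv/=; left.
  move=> t t0 ts; have tI : 0 <= t <= s \/ s <= t <= 0 by left; rewrite !ltW.
  by have [_ le] := hd t tI; split; [exact: dpsi|split].
rewrite (ler0_norm s0) distrC.
have -> : e * - s = e * 0 - e * s by rewrite mulr0 mulrN sub0r.
apply: (@norm_sub_le_of_derive _ _ (fun t => partial k h (t *: basis_vec k + p) - c)
    ( *%R e) (cst e)) => //.
  by apply: cont => t; rewrite in_itv/=; right.
move=> t t0 ts; have tI : 0 <= t <= s \/ s <= t <= 0 by right; rewrite !ltW.
by have [_ le] := hd t tI; split; [exact: dpsi|split].
Qed.

(* Telescoping along a path that changes one coordinate at a time and stays in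
   the sup-norm ball. *)
Lemma increment_le n (h : 'cV[R]_n -> R) (x y z : 'cV[R]_n) (c : 'I_n -> R) (d e : R) :
  (forall w k, `|w - x| < d -> derivable h w (basis_vec k) /\
     `|partial k h w - c k| <= e) ->
  `|y - x| < d -> `|z - x| < d ->
  `|h y - h z - \sum_k c k * (y k 0 - z k 0)| <= n%:R * e * `|y - z|.
Proof.
move=> hd yd zd.
pose p (k : nat) : 'cV[R]_n := \col_j (if (j < k)%N then y j 0 else z j 0).
have p0 : p 0%N = z by apply/matrixP => i j; rewrite ord1 mxE.
have pn : p n = y by apply/matrixP => i j; rewrite ord1 mxE ltn_ord.
have pS (k : 'I_n) : p k.+1 = (y k 0 - z k 0) *: basis_vec k + p k.
  apply/matrixP => i j; rewrite ord1 !mxE eqxx andbT ltnS leq_eqVlt.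
  have [->|ik] := eqVneq i k; first by rewrite eqxx ltnn/= mulr1 subrK.
  by rewrite (negbTE (_ : (i : nat) != k))//= ?mulr0 ?add0r.
have -> : h y - h z = \sum_(k < n) (h (p k.+1) - h (p k)).
  rewrite -p0 -pn -(telescope_sumr (fun k => h (p k)))// big_mkord.
  by [].
rewrite -sumrB (le_trans (ler_norm_sum _ _ _))//.
rewrite -mulrA mulr_natl -[X in _ *+ X]card_ord -sumr_const.
apply: ler_sum => k _; rewrite pS.
have d0 : 0 < d by exact: le_lt_trans yd.
have e0 : 0 <= e.
  by have [_] := hd y k yd; exact: le_trans.
apply: (@le_trans _ _ (e * `|y k 0 - z k 0|)); last first.
  by rewrite ler_wpM2l//; have := coord_le_norm (y - z) k 0; rewrite !mxE.
apply: partial_increment_le => t tI; apply: hd.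
have {yd} yd j : `|y j 0 - x j 0| < d.
  by apply: le_lt_trans yd; have := coord_le_norm (y - x) j 0; rewrite !mxE.
have {zd} zd j : `|z j 0 - x j 0| < d.
  by apply: le_lt_trans zd; have := coord_le_norm (z - x) j 0; rewrite !mxE.
rewrite /Num.Def.normr/= mx_normrE; apply/bigmax_ltP; split=> // -[i j] _ /=.
rewrite ord1 !mxE eqxx andbT.
have [->|ik] := eqVneq i k.
  rewrite ltnn mulr1; have := yd k; have := zd k; rewrite !ltr_norml.
  by case: tI => /andP[? ?] /andP[? ?] /andP[? ?]; apply/andP; split; lra.
by rewrite mulr0 add0r; case: ifP.
Qed.

(** Continuity of the first partial derivatives makes them nearly constant on a ball, which controls
    increments between any two of its points. Taking [z = x] gives the Frechet derivative, and
    varying both points gives a local Lipschitz bound. *)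
Lemma smooth_strict n m (f : 'cV[R]_n -> 'cV[R]_m) x (e : R) :
  smooth_on setT f -> 0 < e ->
  exists2 d, 0 < d & forall y z, `|y - x| < d -> `|z - x| < d ->
    `|f y - f z - Jacobian f x *m (y - z)| <= e * `|y - z|.
Proof.
move=> [D [_ OT fO]] e0; have [_ f1] := fO 1%N.
(* Telescoping over the coordinates costs a factor [n]; the 1 covers [n = 0]. *)
have e1 : 0 < e / (n%:R + 1) by rewrite divr_gt0// ltr_wpDl.
have pc k : continuous (partial k f).
  by move=> w; have [_ [+ _]] := f1 k; apply; exact: OT.
have dk w k : derivable f w (basis_vec k) by have [+ _] := f1 k; apply; exact: OT.
have pE w i k : partial k (fun y => f y i 0) w = partial k f w i 0.
  by rewrite /partial derive_mx// mxE.
have : \forall w \near x, forall k, `|partial k f x - partial k f w| <= e / (n%:R + 1).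
  near=> w; move=> k; move: k; near: w; apply: filter_forall => k.
  by have /(@cvgrPdist_le _ _ _ (nbhs x)) := pc k x; exact.
move=> /nbhs_ballP[d /= d0 hd]; exists d => // y z yd zd.
apply/cV_norm_leP => [|i]; first by rewrite mulr_ge0// ltW.
have -> : (f y - f z - Jacobian f x *m (y - z)) i 0 =
    f y i 0 - f z i 0 - \sum_k Jacobian f x i k * (y k 0 - z k 0).
  by rewrite !mxE; congr (_ - _); apply: eq_bigr => k _; rewrite !mxE.
apply: (@le_trans _ _ (n%:R * (e / (n%:R + 1)) * `|y - z|)); last first.
  by rewrite ler_wpM2r// mulrCA ler_piMr ?ltW// ltr_pdivrMr ?mul1r ?ltrDl ?ltr_wpDl.
apply: (@increment_le _ (fun y => f y i 0) x _ _ (Jacobian f x i) d) => // w k wd.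
split; first by move/derivable_mxP: (dk w k) => /(_ i 0).
rewrite mxE !pE distrC.
have := coord_le_norm (partial k f x - partial k f w) i 0; rewrite !mxE.
move=> /le_trans; apply; apply: hd; rewrite -ball_normE/= distrC.
exact: wd.
Unshelve. all: by end_near. Qed.

End StrictDifferentiability.

(** * Existence of solutions *)

Section Curves.
Context {R : realType}.

Lemma is_derive_coordP m n (z : R -> 'M[R]_(m, n)) (t : R) (d : 'M[R]_(m, n)) :
  is_derive t (1 : R) z d <->
  forall i j, is_derive t (1 : R) (fun s => z s i j) (d i j).
Proof.
split=> [dz i j|dz].
  have dt : derivable z t 1 by exact: (@ex_derive _ _ _ _ _ _ _ dz).
  split; first exact: ((derivable_mxP _ _ _).1 dt).
  by have <- := @derive_val _ _ _ _ _ _ _ dz; rewrite derive_mx// mxE.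
have dt : derivable z t 1.
  by apply/derivable_mxP => i j; exact: (@ex_derive _ _ _ _ _ _ _ (dz i j)).
split=> //; rewrite derive_mx//; apply/matrixP => i j.
by rewrite mxE; exact: (@derive_val _ _ _ _ _ _ _ (dz i j)).
Qed.

Lemma is_derive_expR_lin (k t : R) :
  is_derive t (1 : R) (fun s => expR (k * s)) (k * expR (k * t)).
Proof.
have := is_derive1_comp (is_derive_expR (k * t)) (is_derive_scale k t).
by rewrite mulrC.
Qed.

Lemma is_derive_expR_scale (c k t : R) :
  is_derive t (1 : R) (fun s => c * expR (k * s)) (c * k * expR (k * t)).
Proof. by rewrite -mulrA; exact: is_deriveZ (is_derive_expR_lin k t). Qed.

Lemma is_derive_continuous (V : normedModType R) (z : R -> V) (t : R) d :
  is_derive t (1 : R) z d -> {for t, continuous z}.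
Proof.
move=> dz; apply: differentiable_continuous; apply/derivable1_diffP.
exact: (@ex_derive _ _ _ _ _ _ _ dz).
Qed.

(* The base point [-1] makes [0] an interior point of the domain of integration,
   so that the derivative at [0] is two-sided. *)
Definition antiderivative (g : R -> R) (t : R) : R :=
  (\int[lebesgue_measure]_(s in `[-1, t]) g s)%R -
  (\int[lebesgue_measure]_(s in `[-1, 0]) g s)%R.

Lemma is_derive_antiderivative (g : R -> R) (t : R) : continuous g -> 0 <= t ->
  is_derive t (1 : R) (antiderivative g) (g t).
Proof.
move=> cg t0.
have [| | |dI IE] := continuous_FTC1_closed (f := g) (a := -1) (u := t + 1) _ _ _ (cg t).
- by rewrite ltrDl.
- apply: continuous_compact_integrable; first exact: segment_compact.
  exact: continuous_subspaceT.
- by rewrite (lt_le_trans _ t0)// ltrN10.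
have := @is_deriveB R _ _ _ (cst _) t 1 _ 0 (DeriveDef dI erefl)
  (is_derive_cst (\int[lebesgue_measure]_(s in `[-1, 0]) g s)%R _ _).
by rewrite subr0 -derive1E IE.
Qed.

Lemma antiderivative0 g : antiderivative g 0 = 0.
Proof. by rewrite /antiderivative subrr. Qed.

(** If [x > a], then [2 ^+ k >= k] eventually exceeds [c / (x - a)]. Passages to the limit in the
    Picard scheme take this form. *)
Lemma le_of_geometric_error (x a c : R) :
  (forall k, x <= a + c * 2^-1 ^+ k) -> x <= a.
Proof.
move=> h; rewrite leNgt; apply/negP => ax.
have xa : 0 < x - a by rewrite subr_gt0.
have c0 : 0 < c by have := h 0%N; rewrite expr0 mulr1; lra.
pose k := Num.trunc (c / (x - a)).
have := truncnS_gt (c / (x - a)); rewrite -/k ltr_pdivrMr// => hk.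
have k2 : (k.+1%:R : R) <= 2 ^+ k.+1 by rewrite -natrX ler_nat ltnW// ltn_expl.
have := h k.+1; rewrite exprVn -lerBlDl ler_pdivlMr ?exprn_gt0// leNgt => /negP; apply.
by apply: lt_le_trans hk _; rewrite mulrC ler_wpM2l// ltW.
Qed.

(** The intervals of radius [c * 2^-1 ^+ k] around [u k] meet pairwise, so the supremum of their
    left endpoints lies in all of them. *)
Lemma geometric_limit (u : nat -> R) (c : R) : 0 <= c ->
  (forall k j, `|u (k + j)%N - u k| <= c * 2^-1 ^+ k) ->
  exists l, forall k, `|l - u k| <= c * 2^-1 ^+ k.
Proof.
move=> c0 hu.
have key j k : u j - c * 2^-1 ^+ j <= u k + c * 2^-1 ^+ k.
  have cj i : 0 <= c * 2^-1 ^+ i by rewrite mulr_ge0// exprn_ge0// invr_ge0.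
  have [/subnKC <-|/ltnW/subnKC <-] := leqP k j.
    have := hu k (j - k)%N; rewrite ler_norml => /andP[_].
    by have := cj (k + (j - k))%N; lra.
  have := hu j (k - j)%N; rewrite ler_norml => /andP[+ _].
  by have := cj (j + (k - j))%N; lra.
pose S := range (fun k => u k - c * 2^-1 ^+ k).
have Sub k : ubound S (u k + c * 2^-1 ^+ k) by move=> _ [j _ <-]; exact: key.
exists (sup S) => k; rewrite ler_distl; apply/andP; split.
  apply: ub_le_sup; last by exists k.
  by exists (u 0%N + c * 2^-1 ^+ 0%N); exact: Sub.
by apply: sup_le_ub; [exists (u 0%N - c * 2^-1 ^+ 0%N), 0%N|exact: Sub].
Qed.

End Curves.

Section Picard.
Context {R : realType}.
Variables (n : nat) (H : 'cV[R]_n -> 'cV[R]_n) (K B : R) (x0 : 'cV[R]_n).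
Hypotheses (K0 : 0 < K) (B0 : 0 <= B).
Hypotheses (HK : lipschitz_map K H) (HB : forall v, `|H v| <= B).

(** The invariant of the iteration. It holds for the constant initial curve, is preserved because
    [H] is bounded by [B], survives the limit, and makes the integrands continuous. *)
Let lip_curve (y : R -> 'cV[R]_n) := forall s t : R, 0 <= s -> 0 <= t ->
  `|y s - y t| <= B * `|s - t|.

(* A curve is only controlled for nonnegative times; [Num.max s 0] keeps the
   integrand continuous on the whole line. *)
Let picard_step (y : R -> 'cV[R]_n) (t : R) : 'cV[R]_n :=
  \col_i (x0 i 0 + antiderivative (fun s => H (y (Num.max s 0)) i 0) t).

Let picard_step0 y : picard_step y 0 = x0.
Proof. by apply/matrixP => i j; rewrite ord1 mxE antiderivative0 addr0. Qed.

Let is_derive_picard_step y (t : R) : lip_curve y -> 0 <= t ->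
  is_derive t (1 : R) (picard_step y) (H (y t)).
Proof.
move=> yB t0; apply/is_derive_coordP => i j; rewrite ord1.
have -> : (fun s => picard_step y s i 0) =
    cst (x0 i 0) + antiderivative (fun s => H (y (Num.max s 0)) i 0).
  by apply/funext => s; rewrite mxE.
have cont : continuous (fun s : R => H (y (Num.max s 0)) i 0).
  move=> s; apply/cvgrPdist_le => e e0.
  have KB : 0 < K * B + 1 by rewrite ltr_wpDl// mulr_ge0// ltW.
  near=> r.
  have sr : `|s - r| <= e / (K * B + 1).
    near: r; apply/nbhs_ballP; exists (e / (K * B + 1)); first by rewrite /= divr_gt0.
    by move=> r /ltW.
  have := coord_le_norm (H (y (Num.max s 0)) - H (y (Num.max r 0))) i 0.
  rewrite !mxE => /le_trans; apply; apply: le_trans (HK _ _) _.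
  have m0 (q : R) : 0 <= Num.max q 0 by rewrite le_max lexx orbT.
  move: sr; rewrite ler_pdivlMr// => sr; apply: le_trans sr.
  apply: (@le_trans _ _ (K * (B * `|s - r|))).
    by rewrite ler_pM2l// (le_trans (yB _ _ _ _))// ler_wpM2l// norm_maxB_le.
  by rewrite mulrA mulrC ler_wpM2l// lerDl.
have := is_deriveD (is_derive_cst (x0 i 0) t 1) (is_derive_antiderivative cont t0).
by rewrite add0r max_l.
Unshelve. all: by end_near. Qed.

Let within_step y i a b : lip_curve y -> 0 <= a ->
  {within `[a, b], continuous (fun s => picard_step y s i 0)}.
Proof.
move=> yB a0; apply: derivable_within_continuous => t; rewrite in_itv/= => /andP[at_ _].
have /is_derive_coordP/(_ i 0) d := is_derive_picard_step yB (le_trans a0 at_).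
exact: (@ex_derive _ _ _ _ _ _ _ d).
Qed.

Let lip_picard_step y : lip_curve y -> lip_curve (picard_step y).
Proof.
move=> yB; have le_st (s t : R) : 0 <= s -> s <= t ->
    `|picard_step y t - picard_step y s| <= B * `|t - s|.
  move=> s0 st; rewrite (@ger0_norm _ (t - s)) ?subr_ge0//.
  apply/cV_norm_leP => [|i]; first by rewrite mulr_ge0// subr_ge0.
  rewrite mx_subE mulrBr.
  apply: (@norm_sub_le_of_derive _ (fun t => picard_step y t i 0)
     (fun t => H (y t) i 0) ( *%R B) (cst B)) => //.
  - exact: within_step.
  - by apply: continuous_subspaceT; exact: mulrl_continuous.
  move=> r sr rt; have r0 : 0 <= r by rewrite (le_trans s0)// ltW.
  split; last split.
  - by have /is_derive_coordP := is_derive_picard_step yB r0.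
  - exact: is_derive_scale.
  - exact: le_trans (coord_le_norm _ _ _) (HB _).
move=> s t s0 t0; have [st|/ltW ts] := leP s t; last exact: le_st.
by rewrite distrC (distrC s); exact: le_st.
Qed.

(* The weight [expR (2 * K * t)] turns the Picard operator into a contraction of
   ratio 1/2 on the whole half-line. *)
Let step_contract y z (c : R) : lip_curve y -> lip_curve z -> 0 <= c ->
  (forall t, 0 <= t -> `|y t - z t| <= c * expR (2 * K * t)) ->
  forall t, 0 <= t -> `|picard_step y t - picard_step z t|
    <= c / 2 * expR (2 * K * t).
Proof.
move=> yB zB c0 hc t t0; apply/cV_norm_leP => [|i].
  by rewrite mulr_ge0 ?expR_ge0// divr_ge0.
pose phi s := picard_step y s i 0 - picard_step z s i 0.
have -> : (picard_step y t - picard_step z t) i 0 = phi t - phi 0.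
  by rewrite /phi !picard_step0 subrr subr0 mx_subE.
apply: (@le_trans _ _ (c / 2 * expR (2 * K * t) - c / 2 * expR (2 * K * 0))).
  apply: (@norm_sub_le_of_derive _ phi (fun s => H (y s) i 0 - H (z s) i 0)
     (fun s => c / 2 * expR (2 * K * s))
     (fun s => c / 2 * (2 * K) * expR (2 * K * s))) => //.
  - by move=> x; apply: cvgB; exact: within_step.
  - apply: derivable_within_continuous => s _.
    exact: (@ex_derive _ _ _ _ _ _ _ (is_derive_expR_scale _ _ _)).
  move=> s s0 _; have {}s0 := ltW s0; split; last split.
  - apply: is_deriveB.
      by have /is_derive_coordP := is_derive_picard_step yB s0.
    by have /is_derive_coordP := is_derive_picard_step zB s0.
  - exact: is_derive_expR_scale.
  have := coord_le_norm (H (y s) - H (z s)) i 0; rewrite !mxE => /le_trans; apply.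
  have -> : c / 2 * (2 * K) * expR (2 * K * s) = K * (c * expR (2 * K * s)) by field.
  by apply: le_trans (HK _ _) _; rewrite ler_pM2l//; exact: hc.
by rewrite gerBl mulr_ge0 ?expR_ge0// divr_ge0.
Qed.

Lemma picard_exists : exists z : R -> 'cV[R]_n,
  z 0 = x0 /\ forall t : R, 0 <= t -> is_derive t (1 : R) z (H (z t)).
Proof.
pose y k := iter k picard_step (cst x0).
have yS k : y k.+1 = picard_step (y k) by [].
have yB k : lip_curve (y k).
  elim: k => [s t _ _|k IH]; last by rewrite yS; exact: lip_picard_step.
  by rewrite /y/= subrr normr0 mulr_ge0.
have y_0 k : y k 0 = x0 by case: k => [//|k]; rewrite yS picard_step0.
(* With this [C] the first increment is at most [B * t = C * (2 * K * t)], hence at most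
   [C * expR (2 * K * t)]. *)
have [C C0 CE] : exists2 C, 0 <= C & B = C * (2 * K).
  exists (B / (2 * K)); first by rewrite divr_ge0// mulr_ge0// ltW.
  by rewrite divfK// gt_eqF// mulr_gt0.
have ySk k t : 0 <= t -> `|y k.+1 t - y k t| <= C * 2^-1 ^+ k * expR (2 * K * t).
  elim: k t => [|k IH] t t0.
    rewrite expr0 mulr1; have -> : y 0%N t = y 1%N 0 by rewrite y_0.
    apply: le_trans (yB 1%N _ _ t0 (lexx 0)) _; rewrite subr0 ger0_norm//.
    have -> : B * t = C * (2 * K * t) by rewrite CE !mulrA.
    by rewrite ler_wpM2l// (le_trans _ (expR_ge1Dx _))// lerDr.
  rewrite exprSr mulrA; apply: (step_contract (yB k.+1) (yB k) _ IH) => //.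
  by rewrite mulr_ge0// exprn_ge0// invr_ge0.
have ykj k j t : 0 <= t ->
    `|y (k + j)%N t - y k t| <= 2 * C * expR (2 * K * t) * 2^-1 ^+ k.
  move=> t0; set E := expR _; have E0 : 0 <= E by exact: expR_ge0.
  (* The partial geometric sum is kept exactly, so that the induction on [j] closes. *)
  suff : `|y (k + j)%N t - y k t| <= 2 * C * E * (2^-1 ^+ k - 2^-1 ^+ (k + j)).
    move/le_trans; apply; rewrite ler_wpM2l//; first by rewrite !mulr_ge0.
    by rewrite gerBl exprn_ge0// invr_ge0.
  elim: j => [|j IH]; first by rewrite addn0 !subrr normr0 mulr0.
  have := ySk (k + j)%N t t0; rewrite -/E addnS => h.
  rewrite -(subrK (y (k + j)%N t) (y (k + j).+1 t)) -addrA.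
  apply: le_trans (ler_normD _ _) _; apply: le_trans (lerD h IH) _.
  rewrite exprS; set q := _ ^+ (k + j); set p := _ ^+ k; lra.
have [w wP] : {w : R -> 'cV[R]_n & forall t, 0 <= t -> forall k,
    `|w t - y k t| <= 2 * C * expR (2 * K * t) * 2^-1 ^+ k}.
  apply: (choice (P := fun t v => 0 <= t -> forall k,
    `|v - y k t| <= 2 * C * expR (2 * K * t) * 2^-1 ^+ k)) => t.
  have [t0|t0] := leP 0 t; last by exists 0.
  set c := 2 * C * _; have c0 : 0 <= c by rewrite !mulr_ge0// expR_ge0.
  have [l lP] : {l : 'I_n -> R & forall i k, `|l i - y k t i 0| <= c * 2^-1 ^+ k}.
    apply: (choice (P := fun i a => forall k, `|a - y k t i 0| <= c * 2^-1 ^+ k)) => i.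
    apply: geometric_limit => // k j.
    have := coord_le_norm (y (k + j)%N t - y k t) i 0; rewrite !mxE => /le_trans; apply.
    exact: ykj.
  exists (\col_i l i) => _ k; apply/cV_norm_leP => [|i].
    by rewrite mulr_ge0// exprn_ge0// invr_ge0.
  by rewrite !mxE.
have wB : lip_curve w.
  move=> s t s0 t0.
  apply: (@le_of_geometric_error _ _ _
    (2 * C * expR (2 * K * s) + 2 * C * expR (2 * K * t))) => k.
  have hs := wP s s0 k; have ht := wP t t0 k; have hst := yB k s t s0 t0.
  have -> : w s - w t = (w s - y k s) + (y k s - y k t) + (y k t - w t).
    by rewrite !subrKA.
  rewrite (distrC (w t)) in ht.
  apply: le_trans (ler_normD _ _) _.
  by have := ler_normD (w s - y k s) (y k s - y k t); lra.
have wE t : 0 <= t -> picard_step w t = w t.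
  move=> t0; apply/eqP; rewrite -subr_eq0 -normr_eq0 eq_le normr_ge0 andbT.
  apply: (@le_of_geometric_error _ _ _ (2 * C * expR (2 * K * t))) => k; rewrite add0r.
  have h1 := wP t t0 k.+1; rewrite distrC in h1.
  have h2 : `|picard_step w t - y k.+1 t| <= 2 * C * 2^-1 ^+ k / 2 * expR (2 * K * t).
    apply: (step_contract wB (yB k)) => //.
      by rewrite !mulr_ge0// exprn_ge0// invr_ge0.
    by move=> s s0; rewrite mulrAC; exact: wP.
  rewrite -(subrK (y k.+1 t) (picard_step w t)) -addrA.
  apply: le_trans (ler_normD _ _) _; rewrite exprS in h1; lra.
(* The limit [w] is constrained only at nonnegative times. [picard_step w] agrees with it there and
   has a two-sided derivative at 0 as well. *)
exists (picard_step w); split; first exact: picard_step0.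
by move=> t t0; rewrite wE//; exact: is_derive_picard_step.
Qed.

End Picard.

(** * Differential inequalities *)

Section Comparison.
Context {R : realType}.

(** The product [N s * expR (- m * s)] is nonincreasing. The sign of [m] is free: negative for
    Lyapunov decay, nonnegative for uniqueness. *)
Lemma gronwall_le (N dN : R -> R) (m t : R) : 0 <= t ->
  {within `[0, t], continuous N} ->
  (forall s, 0 < s -> s < t -> is_derive s (1 : R) N (dN s) /\ dN s <= m * N s) ->
  N t <= N 0 * expR (m * t).
Proof.
move=> t0 cN hN.
have : N t * expR (- m * t) <= N 0 * expR (- m * 0).
  apply: (@nonpos_derive_le _ (fun s => N s * expR (- m * s))
    (fun s => (dN s - m * N s) * expR (- m * s))) => //.
    move=> s; apply: cvgM; first exact: cN.
    apply: derivable_within_continuous s => s _.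
    exact: (@ex_derive _ _ _ _ _ _ _ (is_derive_expR_lin _ _)).
  move=> s s0 st; have [dNs le] := hN s s0 st.
  split; last by rewrite mulr_le0_ge0 ?expR_ge0// subr_le0.
  have := is_deriveM dNs (is_derive_expR_lin (- m) s).
  move/is_derive_eq; apply.
  by rewrite -[_ *: _]/(N s * _) -[X in _ + X]/(expR (- m * s) * dN s); ring.
rewrite mulr0 expR0 mulr1 mulNr expRN => h.
by move: h; rewrite ler_pdivrMr ?expR_gt0.
Qed.

Lemma is_derive_bform n (A : 'M[R]_n) (z : R -> 'cV[R]_n) (t : R) (d : 'cV[R]_n) :
  A^T = A -> is_derive t (1 : R) z d ->
  is_derive t (1 : R) (fun s => bform A (z s) (z s)) (2 * bform A (z t) d).
Proof.
move=> AT /is_derive_coordP dz.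
have -> : (fun s => bform A (z s) (z s)) =
    \sum_(i < n) \sum_(j < n) (A i j \*: ((fun s => z s i 0) * (fun s => z s j 0))).
  apply/funext => s; rewrite bformE fct_sumE; apply: eq_bigr => i _.
  rewrite fct_sumE; apply: eq_bigr => j _.
  by rewrite -[RHS]/(A i j * (z s i 0 * z s j 0)); ring.
have D : is_derive t (1 : R)
   (\sum_(i < n) \sum_(j < n) (A i j \*: ((fun s => z s i 0) * (fun s => z s j 0))))
   (\sum_(i < n) \sum_(j < n) (A i j *: (z t i 0 *: d j 0 + z t j 0 *: d i 0))).
  apply: is_derive_sum => i; apply: is_derive_sum => j.
  by apply: is_deriveZ; apply: is_deriveM; exact: dz.
apply: is_derive_eq D _.
have -> : 2 * bform A (z t) d = bform A (z t) d + bform A d (z t).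
  by rewrite [bform A d _]bformC AT mulr2n mulrDl mul1r.
rewrite !bformE -big_split/=; apply: eq_bigr => i _.
rewrite -big_split/=; apply: eq_bigr => j _.
rewrite -[LHS]/(A i j * (z t i 0 * d j 0 + z t j 0 * d i 0)); ring.
Qed.

Lemma within_continuous_bform n (A : 'M[R]_n) (D : set R) (z : R -> 'cV[R]_n) xs :
  {within D, continuous z} ->
  {within D, continuous (fun s => bform A (z s - xs) (z s - xs))}.
Proof.
move=> cz; apply: (@continuous_bform _ (subspace D)) => i s.
rewrite (_ : (fun s => _) = (fun s => z s i 0 - xs i 0)); last first.
  by apply/funext => u; rewrite mx_subE.
apply: cvgB; last exact: cvg_cst.
apply: (@cvg_comp _ _ _ z (fun v : 'cV[R]_n => v i 0) _ (nbhs (z s))).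
  exact: cz.
exact: coord_continuous.
Qed.

(** Truncation acts on each coordinate separately, so it is 1-Lipschitz in the sup norm and
    composing with it preserves Lipschitz constants. *)
Definition clamp n (r : R) (v : 'cV[R]_n) : 'cV[R]_n :=
  \col_i Num.max (- r) (Num.min r (v i 0)).

Lemma clamp_lipschitz n r (v w : 'cV[R]_n) : `|clamp r v - clamp r w| <= `|v - w|.
Proof.
apply/cV_norm_leP => // i; apply: le_trans (coord_le_norm (v - w) i 0).
rewrite !mx_subE !mxE !(maxC (- r)) !(minC r).
exact: le_trans (norm_maxB_le _ _ _) (norm_minB_le _ _ _).
Qed.

Lemma clamp_norm n r (v : 'cV[R]_n) : 0 <= r -> `|clamp r v| <= r.
Proof.
move=> r0; apply/cV_norm_leP => // i; rewrite mxE ler_norml.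
by rewrite le_max lexx/= ge_max ge_min lexx/= andbT; lra.
Qed.

Lemma clamp_id n r (v : 'cV[R]_n) : `|v| <= r -> clamp r v = v.
Proof.
move=> vr; apply/matrixP => i j; rewrite ord1 mxE.
have := le_trans (coord_le_norm v i 0) vr; rewrite ler_norml => /andP[lo hi].
by rewrite min_r// max_r.
Qed.

End Comparison.

(** * Lyapunov stability *)

Section LyapunovStability.
Context {R : realType}.

Lemma subset_time_domain (T : \bar R) (a b : R) : 0 <= a -> (b%:E < T)%E ->
  `[a, b] `<=` time_domain T.
Proof.
move=> a0 bT t /=; rewrite in_itv/= => /andP[at_ tb]; split.
  exact: le_trans at_.
by apply: le_lt_trans bT; rewrite lee_fin.
Qed.

Lemma is_solution_within n (F : 'cV[R]_n -> 'cV[R]_n) T x a b :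
  is_solution F T x -> 0 <= a -> (b%:E < T)%E -> {within `[a, b], continuous x}.
Proof.
move=> [cx _] a0 bT; apply: continuous_subspaceW cx; exact: subset_time_domain.
Qed.

Lemma is_solution_of_is_derive n (F : 'cV[R]_n -> 'cV[R]_n) (x : R -> 'cV[R]_n) :
  (forall t : R, 0 <= t -> is_derive t (1 : R) x (F (x t))) -> is_solution F +oo x.
Proof.
move=> dx; split=> [|t t0 _]; last exact: dx (ltW t0).
apply: continuous_in_subspaceT => t; rewrite inE => -[t0 _].
exact: is_derive_continuous (dx t t0).
Qed.

Lemma eq_is_solution n (F G : 'cV[R]_n -> 'cV[R]_n) T x : is_solution F T x ->
  (forall t, time_domain T t -> F (x t) = G (x t)) -> is_solution G T x.
Proof.
move=> [cx dx] FG; split=> // t t0 tT; rewrite -FG; first exact: dx.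
by split=> //; exact: ltW.
Qed.

Section Trapping.
Variables (n : nat) (P : 'M[R]_n) (xs : 'cV[R]_n).
Hypothesis PT : P^T = P.

Let V (x : 'cV[R]_n) := bform P (x - xs) (x - xs).

Let is_derive_V G T x t : is_solution G T x -> 0 < t -> (t%:E < T)%E ->
  is_derive t (1 : R) (fun s => V (x s)) (2 * bform P (x t - xs) (G (x t))).
Proof.
move=> [_ dx] t0 tT; apply: is_derive_bform => //.
have := is_deriveB (dx t t0 tT) (is_derive_cst xs t 1).
by rewrite subr0.
Qed.

(** Continuation argument: consider the supremum [t1] of the times up to which the solution stays in
    the sublevel set. The field [G] is arbitrary because the clamped field must be trapped before it
    is known to agree with [F] along its solution. *)
Lemma solution_trapped (c : R) G T x : is_solution G T x -> (0 < T)%E ->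
  (forall y, V y < c -> bform P (y - xs) (G y) <= 0) -> V (x 0) < c ->
  forall t, time_domain T t -> V (x t) < c.
Proof.
move=> solx T0 dec Vx0 t2 [t20 t2T]; rewrite ltNge; apply/negP => ct2.
pose A := [set t : R | 0 <= t <= t2 /\ forall s, 0 <= s <= t -> V (x s) < c].
have A0 : A 0.
  split; first by rewrite lexx.
  by move=> s; rewrite -eq_le => /eqP <-.
have ubA : ubound A t2 by move=> t [/andP[]].
have hsA : has_sup A by split; [exists 0|exists t2].
set t1 := sup A.
have t10 : 0 <= t1 by apply: ub_le_sup => //; exists t2.
have t12 : t1 <= t2 by apply: ge_sup => //; exists 0.
have before s : 0 <= s -> s < t1 -> V (x s) < c.
  rewrite -subr_gt0 => s0 st1; have [u [_ hu] su] := sup_adherent st1 hsA.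
  by apply: hu; rewrite s0/= ltW//; move: su; rewrite -/t1; lra.
have t1T : (t1%:E < T)%E by apply: le_lt_trans t2T; rewrite lee_fin.
(* Continuity alone would give only [<=] at [t1]. Monotonicity before [t1] compares with [V (x 0)]
   and keeps the inequality strict, so the solution stays inside a little longer. *)
have Vt1 : V (x t1) < c.
  apply: le_lt_trans Vx0.
  apply: (@nonpos_derive_le _ (fun s => V (x s))
    (fun s => 2 * bform P (x s - xs) (G (x s)))) => //.
    by apply: within_continuous_bform; exact: is_solution_within solx _ _.
  move=> s s0 st1; split.
    by apply: is_derive_V solx s0 _; apply: lt_trans t1T; rewrite lte_fin.
  by rewrite mulr_ge0_le0//; apply: dec; exact: before (ltW s0) st1.
have {}t12 : t1 < t2.
  rewrite lt_neqAle t12 andbT; apply/eqP => t12E.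
  by move: Vt1; rewrite t12E ltNge ct2.
have : {within `[t1, t2], continuous (fun s => V (x s))}.
  by apply: within_continuous_bform; exact: is_solution_within solx _ _.
move=> /(continuous_within_itvP _ t12)[_ /= cV _].
have : \forall s \near t1^'+, V (x s) < c.
  by move/cvgr_lt : cV; apply.
move=> [/= d d0 hd].
pose t3 := Num.min t2 (t1 + d / 2).
have t13 : t1 < t3 by rewrite lt_min t12/= ltrDl divr_gt0.
have : A t3.
  split; first by rewrite ge_min lexx andbT (ltW (le_lt_trans t10 t13)).
  move=> s /andP[s0 st3]; have [|t1s] := ltP s t1; first exact: before.
  have [<-//|t1s'] := eqVneq t1 s.
  apply: hd; last by rewrite /= lt_neqAle t1s'.
  rewrite /= ltr_distlC; move: st3; rewrite le_min => /andP[_ st3].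
  by apply/andP; split; lra.
move=> At3; have : t3 <= t1 by apply: ub_le_sup => //; exists t2.
by rewrite leNgt t13.
Qed.

Lemma solution_decay (k : R) G T x : is_solution G T x ->
  (forall t, time_domain T t ->
    bform P (x t - xs) (G (x t)) <= - k * V (x t)) ->
  forall t, time_domain T t -> V (x t) <= V (x 0) * expR (- (2 * k) * t).
Proof.
move=> solx dec t [t0 tT].
apply: (@gronwall_le _ (fun s => V (x s))
  (fun s => 2 * bform P (x s - xs) (G (x s)))) => //.
  by apply: within_continuous_bform; exact: is_solution_within solx _ _.
move=> s s0 st; have sT : (s%:E < T)%E by apply: lt_trans tT; rewrite lte_fin.
split; first exact: is_derive_V solx s0 sT.
have := dec s; rewrite /time_domain/= => /(_ (conj (ltW s0) sT)); lra.
Qed.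

End Trapping.

(** Gronwall's inequality for the squared Euclidean distance. A Lipschitz bound on [D] suffices
    since both solutions remain in [D], which trapping will provide. *)
Lemma solution_unique n (F : 'cV[R]_n -> 'cV[R]_n) (D : set 'cV[R]_n) (K : R) T x y :
  0 <= K -> (forall v w, D v -> D w -> `|F v - F w| <= K * `|v - w|) ->
  is_solution F T x -> is_solution F T y ->
  (forall t, time_domain T t -> D (x t)) -> (forall t, time_domain T t -> D (y t)) ->
  x 0 = y 0 -> forall t, time_domain T t -> x t = y t.
Proof.
move=> K0 FK solx soly xD yD xy0 t [t0 tT].
pose z s := x s - y s; pose c : R := entry_sum (1%:M : 'M[R]_n).
have T1 : (1%:M : 'M[R]_n)^T = 1%:M by exact: tr_scalar_mx.
have c0 : 0 <= c by exact: entry_sum_ge0.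
(* The subtracted 0 matches the centred form in [within_continuous_bform]. *)
have : bform 1%:M (z t - 0) (z t - 0) <=
    bform 1%:M (z 0 - 0) (z 0 - 0) * expR (2 * c * K * t).
  apply: (@gronwall_le _ (fun s => bform 1%:M (z s - 0) (z s - 0))
     (fun s => 2 * bform 1%:M (z s - 0) (F (x s) - F (y s)))) => //.
    apply: within_continuous_bform => s.
    by apply: cvgB; [exact: (is_solution_within solx)|exact: (is_solution_within soly)].
  move=> s s0 st; have sT : (s%:E < T)%E by apply: lt_trans tT; rewrite lte_fin.
  have Ts : time_domain T s by split=> //; exact: ltW.
  rewrite subr0; split.
    under eq_fun do rewrite subr0.
    apply: is_derive_bform => //; apply: is_deriveB; first exact: solx.2.
    exact: soly.2.
  rewrite -!mulrA ler_pM2l//; apply: le_trans (ler_norm _) _.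
  apply: le_trans (norm_bform_le _ _ _) _; rewrite -/c ler_wpM2l//.
  apply: (@le_trans _ _ (`|z s| * (K * `|z s|))).
    by rewrite ler_wpM2l//; apply: FK; [exact: xD|exact: yD].
  by rewrite mulrCA ler_wpM2l// -expr2 bform1 norm_le_sqnorm.
have z0 : z 0 = 0 by rewrite /z xy0 subrr.
rewrite !subr0 z0 bform0r mul0r bform1 => zt.
apply/eqP; rewrite -subr_eq0; apply/eqP/sqnorm_eq0.
by apply/eqP; rewrite eq_le zt sqnorm_ge0.
Qed.

Lemma lyapunov_exponential_stability n (F : 'cV[R]_n -> 'cV[R]_n) (xs : 'cV[R]_n)
    (P : 'M[R]_n) (r K k : R) :
  sym_posdef P -> F xs = 0 -> 0 < r -> 0 < K -> 0 < k ->
  (forall v w, `|v - xs| <= r -> `|w - xs| <= r -> `|F v - F w| <= K * `|v - w|) ->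
  (forall v, `|v - xs| <= r ->
     bform P (v - xs) (F v) <= - k * bform P (v - xs) (v - xs)) ->
  exponentially_stable_equilibrium F xs.
Proof.
move=> Ppos Fxs r0 K0 k0 FK dec; split=> //.
have PT : P^T = P by case: Ppos.
have [al al0 Pal] := posdef_lower_bound Ppos.
pose be := entry_sum P + 1; have be0 : 0 < be by rewrite ltr_wpDl// entry_sum_ge0.
have Pbe v : bform P v v <= be * sqnorm v.
  apply: le_trans (ler_norm _) _; apply: le_trans (norm_bform_le _ _ _) _.
  rewrite ler_pM ?entry_sum_ge0 ?mulr_ge0 ?lerDl// -expr2.
  exact: norm_le_sqnorm.
have VP v : 0 <= bform P v v by rewrite (le_trans _ (Pal v))// mulr_ge0 ?sqnorm_ge0// ltW.
have Vr v : bform P v v < al * r ^+ 2 -> `|v| <= r.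
  move=> /(le_lt_trans (Pal v)); rewrite ltr_pM2l// => h.
  rewrite -(@ler_pXn2r _ 2)// ?nnegrE ?(ltW r0)//.
  exact: le_trans (norm_le_sqnorm v) (ltW h).
(* From [al * sqnorm v <= bform P v v <= be * sqnorm v]: the ball of this radius lies in the
   sublevel set of level [al * r ^+ 2], which lies in the sup-norm ball of radius [r]; [be / al] is
   the square of the overshoot constant. The form decays at the rate [2 * k], hence the norm at the
   rate [k]. *)
exists (Num.sqrt (al * r ^+ 2 / be)), (Num.sqrt (be / al)), k.
split; rewrite ?sqrtr_gt0 ?divr_gt0 ?mulr_gt0 ?exprn_gt0// => x0 x0d.
have Vx0 : bform P (x0 - xs) (x0 - xs) < al * r ^+ 2.
  apply: le_lt_trans (Pbe _) _; rewrite mulrC -ltr_pdivlMr//.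
  by move: x0d; rewrite ltr_sqrt ?divr_gt0 ?mulr_gt0 ?exprn_gt0.
have trapped G T x : is_solution G T x -> (0 < T)%E -> x 0 = x0 ->
    (forall v, `|v - xs| <= r -> G v = F v) ->
    forall t, time_domain T t -> `|x t - xs| <= r.
  move=> solx T0 x0E GF t tT; apply/Vr.
  apply: (solution_trapped PT solx T0) tT => [y /Vr yr|]; last by rewrite x0E.
  rewrite GF//; apply: le_trans (dec _ yr) _.
  by rewrite mulNr oppr_le0 mulr_ge0// ltW.
have [y [soly y0]] : exists y, is_solution F +oo y /\ y 0 = x0.
  (* Bounded and globally Lipschitz, and equal to [F] near [xs]. *)
  pose G v := F (xs + clamp r (v - xs)).
  have cl v : `|xs + clamp r (v - xs) - xs| <= r.
    by rewrite addrAC subrr add0r clamp_norm// ltW.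
  have GF v : `|v - xs| <= r -> G v = F v.
    by move=> vr; rewrite /G clamp_id// addrC subrK.
  have [||||y [y0 dy]] := @picard_exists R n G K (K * r) x0 => //.
  - by rewrite mulr_ge0// ltW.
  - move=> v w; apply: le_trans (FK _ _ (cl v) (cl w)) _; rewrite ler_pM2l//.
    rewrite opprD addrACA subrr add0r (le_trans (clamp_lipschitz _ _ _))//.
    by rewrite opprB addrA subrK.
  - move=> v; have xs0 : `|xs - xs| <= r by rewrite subrr normr0 ltW.
    have := FK _ _ (cl v) xs0; rewrite Fxs subr0 => /le_trans; apply.
    by rewrite ler_pM2l//; exact: cl.
  have solG := is_solution_of_is_derive dy.
  exists y; split=> //; apply: (eq_is_solution solG) => t tT; apply/GF.
  exact: (trapped G +oo%E y solG (ltry 0) y0 GF t tT).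
split; first by exists y.
move=> T x T0 solx x0E.
have xr := trapped F T x solx T0 x0E (fun _ _ => erefl).
have solyT : is_solution F T y.
  split; last by move=> t t0 _; apply: soly.2 => //; exact: ltry.
  apply: continuous_subspaceW soly.1 => t [t0 _]; split=> //; exact: ltry.
have yr := trapped F T y solyT T0 y0 (fun _ _ => erefl).
split.
  exists y; split=> // t tT; apply/esym.
  apply: (@solution_unique _ F [set v | `|v - xs| <= r] K T x y) => //.
  - exact: ltW.
  - by rewrite x0E.
move=> t tT.
have := solution_decay PT solx (fun t tT => dec _ (xr t tT)) tT.
rewrite x0E => decay.
have n0 v : 0 <= norm2 v :> R by exact: sqrtr_ge0.
rewrite -(@ler_pXn2r _ 2)// ?nnegrE ?mulr_ge0 ?expR_ge0 ?sqrtr_ge0//.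
rewrite !exprMn !norm2_sqr sqr_sqrtr ?divr_ge0 ?(ltW be0) ?(ltW al0)//.
rewrite -(ler_pM2l al0); apply: le_trans (Pal _) _; apply: le_trans decay _.
have -> : - (2 * k) * t = - (k * t) + - (k * t) by ring.
rewrite expRD -expr2.
have -> : al * (be / al * expR (- (k * t)) ^+ 2 * sqnorm (x0 - xs)) =
   be * sqnorm (x0 - xs) * expR (- (k * t)) ^+ 2 by field; rewrite gt_eqF.
by rewrite ler_wpM2r ?sqr_ge0.
Qed.

End LyapunovStability.

(** * Linearization at the equilibrium *)

Section Equilibrium.
Context {R : realType}.

Lemma derivative_along_equilibrium n (F : 'cV[R]_n -> 'cV[R]_n)
    (M : 'cV[R]_n -> 'M[R]_n) x :
  F x = 0 -> derivative_along F M x = 0.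
Proof.
move=> Fx; apply/matrixP => i j; rewrite !mxE big1// => k _.
by rewrite Fx mxE mulr0.
Qed.

Lemma frechet_smooth n m (f : 'cV[R]_n -> 'cV[R]_m) x :
  smooth_on setT f -> frechet_at f x (Jacobian f x).
Proof.
move=> fs e e0; have [d d0 hd] := smooth_strict x fs e0.
near=> y; apply: hd; last by rewrite subrr normr0.
rewrite distrC; near: y; apply/nbhs_ballP; exists d => // y.
by rewrite -ball_normE.
Unshelve. all: by end_near. Qed.

(** An absolute value on an interval is at most its larger value at the endpoints. *)
Lemma Sym_entry_bounds n (L U B : 'M[R]_n) i j :
  mx_entry_le L B -> mx_entry_le B U ->
  `|Sym B i j| <= Num.max `|L i j + L j i| `|U i j + U j i|.
Proof.
move=> LB BU; have := LB i j; have := LB j i; have := BU i j; have := BU j i.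
have -> : Sym B i j = B i j + B j i by rewrite !mxE.
rewrite le_max => u1 u2 l1 l2.
have [s0|s0] := leP 0 (B i j + B j i).
  by apply/orP; right; rewrite (le_trans _ (ler_norm _))// ger0_norm//; lra.
apply/orP; left; rewrite (ltr0_norm s0) -normrN (le_trans _ (ler_norm _))//; lra.
Qed.

End Equilibrium.

Theorem theorem2 (R : realType) (n m : nat)
    (X : set 'cV[R]_n) (f : 'cV[R]_n -> 'cV[R]_n) (g : 'M[R]_(n, m))
    (theta : network R n m) (a b : R)
    (xs : 'cV[R]_n) (M : 'cV[R]_n -> 'M[R]_n) (rho c1 c2 : R)
    (Lt Ut Lp Up : 'M[R]_n) :
  let u := network_feedback theta in
  let F := fun x => f x + g *m u x in
  let eta := c1 + c2 in
  let L := Lt + Lp in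
  let U := Ut + Up in
  compact X ->
  smooth_on setT f ->
  0 < a -> network_slopes a b theta ->
  X xs -> F xs = 0 ->
  smooth_on X M -> (forall x, X x -> sym_posdef (M x)) ->
  0 < rho ->
  ((2 * rho)%R%:E * ereal_sup [set (lambda_max (M s))%:E | s in X] <= c1%:E)%E ->
  (ereal_sup [set (lambda_max (Sym (M s *m Jacobian f s)))%:E | s in X]
     <= c2%:E)%E ->
  (forall x, X x ->
     mx_entry_le Lt (M x *m g *m Jacobian u x) /\
     mx_entry_le (M x *m g *m Jacobian u x) Ut) ->
  (forall x, X x ->
     mx_entry_le Lp (derivative_along F M x) /\
     mx_entry_le (derivative_along F M x) Up) ->
  (forall i : 'I_n,
     2 * U i i + eta <=
       - \sum_(j | j != i)
           Num.max `|L i j + L j i| `|U i j + U j i|) ->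
  exponentially_stable_equilibrium F xs.
Proof.
move=> u F eta L U _ fs a0 us Xxs Fxs _ Mpos rho0 hc1 hc2 ut pt dom.
set P := M xs in hc1 hc2; have Ppos : sym_posdef P := Mpos xs Xxs.
pose A := Jacobian f xs; pose D := Jacobian u xs.
pose B := P *m g *m D; pose J := A + g *m D.
have c1P : 2 * rho * lambda_max P <= c1.
  rewrite -lee_fin EFinM; apply: le_trans hc1.
  rewrite lee_pmul2l//; first by apply: ereal_sup_ubound; exists xs.
  by rewrite lte_fin mulr_gt0.
have c2A : lambda_max (Sym (P *m A)) <= c2.
  rewrite -lee_fin; apply: le_trans hc2.
  by apply: ereal_sup_ubound; exists xs.
have [LB BU] : mx_entry_le L B /\ mx_entry_le B U.
  have [Lu Uu] := ut xs Xxs; have [Lm Um] := pt xs Xxs.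
  rewrite derivative_along_equilibrium// in Lm Um.
  have Z i j : (0 : 'M[R]_n) i j = 0 by rewrite mxE.
  split=> i j.
    by rewrite [leLHS]mxE; have := Lu i j; have := Lm i j; rewrite Z /B /D; lra.
  by rewrite [leRHS]mxE; have := Uu i j; have := Um i j; rewrite Z /B /D; lra.
have SymT (Q : 'M[R]_n) : (Sym Q)^T = Sym Q by rewrite /Sym linearD/= trmxK addrC.
have SB v : bform (Sym B) v v <= - eta * sqnorm v.
  apply: bform_le_of_diag_dominance => // i.
  have S1 : \sum_(j | j != i) `|Sym B i j| <=
      \sum_(j | j != i) Num.max `|L i j + L j i| `|U i j + U j i|.
    by apply: ler_sum => j _; exact: Sym_entry_bounds.
  have S2 : Sym B i i <= 2 * U i i.
    by rewrite /Sym !mxE; have := BU i i; rewrite !mxE; lra.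
  by have := dom i; lra.
have lin v : bform P v (J *m v) <= - rho * bform P v v.
  have SA := bform_le_lambda_max v (SymT (P *m A)).
  have SP := bform_le_lambda_max v Ppos.1.
  have SBv := SB v; have s0 := sqnorm_ge0 v.
  (* The two summands are at most [c2] and [- (c1 + c2)] times [sqnorm v]. What remains,
     [- c1 * sqnorm v], is at most [- 2 * rho * lambda_max P * sqnorm v], hence at most
     [- 2 * rho * bform P v v]. *)
  have E : 2 * bform P v (J *m v) = bform (Sym (P *m A)) v v + bform (Sym B) v v.
    by rewrite bform_mul mulmxDr bformDm mulmxA !bform_Sym mulrDr.
  have h1 : lambda_max (Sym (P *m A)) * sqnorm v <= c2 * sqnorm v.
    by rewrite ler_wpM2r.
  have h2 : 2 * rho * (lambda_max P * sqnorm v) <= c1 * sqnorm v.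
    by rewrite mulrA ler_wpM2r.
  have h3 : 2 * rho * bform P v v <= 2 * rho * (lambda_max P * sqnorm v).
    by rewrite ler_wpM2l// mulr_ge0// ltW.
  by move: SBv; rewrite /eta; lra.
have [al al0 Pal] := posdef_lower_bound Ppos.
have [Ku uK uD] := network_frechet xs a0 us.
have FD : frechet_at F xs J.
  apply: frechet_add; first exact: frechet_smooth.
  have := frechet_affine g 0 uD.
  by under eq_fun do rewrite addr0.
pose p := entry_sum P; have p0 : 0 <= p by exact: entry_sum_ge0.
have p1 : 0 < p + 1 by rewrite ltr_wpDl.
(* With this accuracy the remainder adds at most [rho / 2 * al * sqnorm w] to the form, which is at
   most [rho / 2 * bform P w w]. *)
have e0 : 0 < rho / 2 * al / (p + 1) by rewrite !(divr_gt0, mulr_gt0).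
have /nbhs_ballP[d1 /= d10 hd1] := FD _ e0.
(* Here only a Lipschitz constant for [f] is wanted, so accuracy 1 is enough. *)
have [d2 d20 hd2] := smooth_strict xs fs ltr01.
(* Halving places the closed ball of radius [r] inside both open balls. *)
pose r := Num.min d1 d2 / 2.
have r0 : 0 < r by rewrite divr_gt0// lt_min d10.
have [rd1 rd2] : r < d1 /\ r < d2.
  apply/andP; rewrite -lt_min /r ltr_pdivrMr// ltr_pMr ?ltr1n//.
  by rewrite lt_min d10.
have K0 : 0 < entry_sum A + 1 + entry_sum g * `|Ku|.
  by rewrite ltr_wpDr ?mulr_ge0 ?entry_sum_ge0// ltr_wpDl// entry_sum_ge0.
apply: (lyapunov_exponential_stability Ppos Fxs r0 K0 (k := rho / 2)).
- by rewrite divr_gt0.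
- move=> v w vr wr.
  have fvw := hd2 v w (le_lt_trans vr rd2) (le_lt_trans wr rd2).
  have -> : F v - F w = (f v - f w - A *m (v - w)) + A *m (v - w) + g *m (u v - u w).
    by rewrite /F subrK mulmxBr opprD addrACA.
  apply: le_trans (ler_normD _ _) _; rewrite [leRHS]mulrDl lerD//.
    apply: le_trans (ler_normD _ _) _; rewrite [leRHS]mulrDl addrC lerD//.
    exact: norm_mulmx_le.
  apply: le_trans (norm_mulmx_le _ _) _; rewrite -mulrA ler_wpM2l ?entry_sum_ge0//.
  by apply: le_trans (uK _ _) _; rewrite ler_wpM2r// ler_norm.
move=> v vr; set w := v - xs.
have : `|F v - F xs - J *m w| <= rho / 2 * al / (p + 1) * `|w|.
  by apply: hd1; rewrite -ball_normE/= distrC (le_lt_trans vr rd1).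
rewrite Fxs subr0 => rem.
have -> : F v = J *m w + (F v - J *m w) by rewrite addrC subrK.
rewrite bformDr.
have h1 := lin w.
have h2 : bform P w (F v - J *m w) <= rho / 2 * al * sqnorm w.
  apply: le_trans (ler_norm _) _; apply: le_trans (norm_bform_le _ _ _) _.
  rewrite -/p.
  apply: (@le_trans _ _ ((p + 1) * (`|w| * (rho / 2 * al / (p + 1) * `|w|)))).
    by apply: ler_pM; rewrite ?mulr_ge0 ?lerDl// ler_wpM2l.
  have -> : (p + 1) * (`|w| * (rho / 2 * al / (p + 1) * `|w|)) =
      rho / 2 * al * `|w| ^+ 2 by field; rewrite gt_eqF.
  by rewrite ler_pM2l ?norm_le_sqnorm// mulr_gt0// divr_gt0.
have h3 : rho / 2 * (al * sqnorm w) <= rho / 2 * bform P w w.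
  by rewrite ler_wpM2l// divr_ge0// ltW.
by lra.
Qed.
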